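(* Every planar 3-tree has a plane $\delta_3$-obstacle embedding.
   Context: Graphs are finite, simple and undirected. A 3-tree is a graph obtained from the complete graph $K_4$ by repeatedly choosing a clique on three vertices and adding a new vertex adjacent to exactly these three vertices. For $x\in\mathbb{R}^2$ and $i\in\{0,\dots,5\}$ let $Q^3_i(x)=x+\{r(\cos\theta,\sin\theta): r\ge 0,\ i\pi/3\le\theta\le (i+1)\pi/3\}$. A curve is a continuous map $f:[0,1]\to\mathbb{R}^2$; it is $\delta_3$-monotone if for some $i$ we have $f(b)\in Q^3_i(f(a))$ for all $0\le a\le b\le 1$ (these are the geodesics of the polyhedral distance $\delta_3$ whose unit ball is the regular hexagon with vertices $(\cos(i\pi/3),\sin(i\pi/3))$). A plane $\delta_3$-obstacle embedding of $G$ is a pair $(\varphi,c)$, where $\varphi:V(G)\to\mathbb{R}^2$ is injective and $c$ assigns to each edge $uw$ a $\delta_3$-monotone curve with endpoints $\varphi(u),\varphi(w)$, such that the drawing is plane (edge curves are simple, contain no vertex points other than their endpoints, and two distinct edge curves meet only at a common endpoint), and such that whenever there is a path in $G$ with distinct end vertices $u,w$ whose edge curves concatenate to a $\delta_3$-monotone curve, then $uw\in E(G)$. *)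

(* Defs.v *)
From HB Require Import structures.
From mathcomp Require Import all_boot all_order all_algebra.
From mathcomp Require Import all_classical all_reals all_analysis.

Set Implicit Arguments.
Unset Strict Implicit.
Unset Printing Implicit Defensive.

Import Order.TTheory GRing.Theory Num.Theory.
Import numFieldNormedType.Exports.

Local Open Scope classical_set_scope.
Local Open Scope ring_scope.

(* Throughout, a finite simple graph is a symmetric irreflexive relation [e]
   on a finite type [V]; the two properties are hypotheses of the theorem. *)

Definition clique (V : finType) (e : rel V) (K : {set V}) : Prop :=
  {in K &, forall x y, x != y -> e x y}.

(* [three_tree_on e S]: the subgraph of [e] induced by [S] arises from a K_4
   by successively adding vertices, each adjacent, among the vertices already
   present, exactly to those of a triangle. *)
Inductive three_tree_on (V : finType) (e : rel V) : {set V} -> Prop :=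
| three_tree_K4 (S : {set V}) :
    #|S| = 4%N -> clique e S -> three_tree_on e S
| three_tree_add (S K : {set V}) (v : V) :
    three_tree_on e S -> v \notin S ->
    K \subset S -> #|K| = 3%N -> clique e K ->
    (forall x, x \in S -> e v x = (x \in K)) ->
    three_tree_on e (v |: S)%SET.

Definition three_tree (V : finType) (e : rel V) : Prop :=
  three_tree_on e [set: V]%SET.

Section Curves.
Variable R : realType.

(* A curve [0, 1] -> R^2 is a total function on [R] of which only the
   restriction to [0, 1] is ever considered. *)
Definition curve (f : R -> R * R) : Prop := {within `[0, 1], continuous f}.

Definition sector3 (i : 'I_6) (x : R * R) : set (R * R) :=
  [set y | exists r t : R,
    [/\ 0 <= r, i%:R * pi / 3 <= t <= i.+1%:R * pi / 3
      & y = x + (r * cos t, r * sin t)]].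

Definition delta3_monotone (f : R -> R * R) : Prop :=
  exists i : 'I_6, forall a b : R, 0 <= a -> a <= b -> b <= 1 ->
    sector3 i (f a) (f b).

Definition curve_rev (f : R -> R * R) : R -> R * R := fun t => f (1 - t).

Definition curve_cat (f g : R -> R * R) : R -> R * R :=
  fun t => if t <= 2^-1 then f (2 * t) else g (2 * t - 1).

End Curves.

Section Drawings.
Variables (R : realType) (V : finType) (e : rel V).

(* The curve of the undirected edge uw is given in both directions: [c u w]
   runs from [phi u] to [phi w], and [c w u] is the same curve reversed. *)
Record plane_drawing (phi : V -> R * R) (c : V -> V -> R -> R * R) : Prop := {
  drawing_inj : injective phi ;
  drawing_curve : forall u w, e u w -> curve (c u w) ;
  drawing_ends : forall u w, e u w -> c u w 0 = phi u /\ c u w 1 = phi w ;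
  drawing_rev : forall u w, e u w ->
    forall t : R, 0 <= t <= 1 -> c w u t = curve_rev (c u w) t ;
  drawing_simple : forall u w, e u w ->
    forall s t : R, 0 <= s <= 1 -> 0 <= t <= 1 -> c u w s = c u w t -> s = t ;
  drawing_vertex : forall u w, e u w ->
    forall (v : V) (t : R), 0 <= t <= 1 -> c u w t = phi v ->
      v \in [:: u; w] ;
  drawing_cross : forall u w x y, e u w -> e x y ->
    [set u; w]%SET != [set x; y]%SET ->
    forall s t : R, 0 <= s <= 1 -> 0 <= t <= 1 -> c u w s = c x y t ->
      exists v : V,
        [/\ v \in [:: u; w], v \in [:: x; y] & c u w s = phi v] }.

Definition planar : Prop :=
  exists (phi : V -> R * R) (c : V -> V -> R -> R * R), plane_drawing phi c.

(* Concatenation of the edge curves along the walk u, v, p. *)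
Fixpoint walk_curve (c : V -> V -> R -> R * R) (u v : V) (p : seq V) :
    R -> R * R :=
  if p is w :: q then curve_cat (c u v) (walk_curve c v w q) else c u v.

Record delta3_obstacle_embedding
    (phi : V -> R * R) (c : V -> V -> R -> R * R) : Prop := {
  embedding_plane : plane_drawing phi c ;
  embedding_monotone : forall u w, e u w -> delta3_monotone (c u w) ;
  embedding_obstacle : forall (u v : V) (p : seq V),
    path e u (v :: p) -> uniq [:: u, v & p] -> u != last v p ->
    delta3_monotone (walk_curve c u v p) -> e u (last v p) }.

End Drawings.

Arguments planar R {V} e.

(* Main.v *)
Require Import Defs.
From mathcomp Require Import all_boot all_order all_algebra.
From mathcomp Require Import all_classical all_reals all_analysis.
From mathcomp Require Import fintype finset ring lra.

Set Implicit Arguments.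
Unset Strict Implicit.
Unset Printing Implicit Defensive.

Import Order.TTheory GRing.Theory Num.Theory.
Import numFieldNormedType.Exports.

Local Open Scope ring_scope.

(* Planarity is only used to exclude K_{3,3}, by a parity argument on the
   crossings of difference vectors with a ray: hence no triangle has three common
   neighbours. The graph is then rebuilt from a triangle with a single common
   neighbour, the outer face, and each new vertex is put inside a current face.

   The drawing is straight, with edges interior to the six sectors. Each corner
   of a face carries one prescribed sector for all edges to be drawn there. The
   sectors prescribed around a vertex are neither opposite to each other nor to
   existing edges, so a new edge never extends an old one monotonically; only
   two edges of a new vertex may do so, and their other ends are adjacent. A new
   vertex is placed very close to a corner of its face; a finite check shows that
   the types of faces that arise can always be subdivided again. A monotone path
   of two edges u v w then forces the edge u w, which lies in the same sector, and
   longer monotone paths are shortened one edge at a time. *)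

(** * Sectors of the hexagon *)

Section Sectors.
Variable R : realFieldType.
Implicit Types (u v w : R * R) (s t : nat).

(* The pair [(x, y)] stands for the vector x (1, 0) + y (cos (pi/3), sin (pi/3)),
   so that the six sectors have integral equations: [hexrot] is the clockwise
   rotation by pi/3, and sector 0 is the quadrant x, y > 0. *)
Definition hexrot v : R * R := (v.1 + v.2, - v.1).

Definition in_sector s v :=
  (0 < (iter s hexrot v).1) && (0 < (iter s hexrot v).2).

Definition in_closed_sector s v :=
  (0 <= (iter s hexrot v).1) && (0 <= (iter s hexrot v).2).

(* Equal to 6 when [v] lies on the boundary of a sector. *)
Definition sector v : nat := find (in_sector^~ v) (iota 0 6).

Definition det u v : R := u.1 * v.2 - u.2 * v.1.

Lemma in_sector_closed s v : in_sector s v -> in_closed_sector s v.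
Proof. by move=> /andP[h1 h2]; rewrite /in_closed_sector !ltW. Qed.

(** The second sector is closed because monotonicity of a curve only speaks of closed sectors. *)
Lemma closed_sector_inj s t v :
  (s < 6)%N -> (t < 6)%N -> in_sector s v -> in_closed_sector t v -> s = t.
Proof.
case: v => x y.
by case: s => [|[|[|[|[|[|//]]]]]]; case: t => [|[|[|[|[|[|//]]]]]];
  rewrite /in_sector /in_closed_sector /= => _ _ /andP[h1 h2] /andP[h3 h4];
  first [by [] | exfalso; lra].
Qed.

Lemma sectorE s v : (s < 6)%N -> in_sector s v -> sector v = s.
Proof.
move=> s6 hs; have hh : has (in_sector^~ v) (iota 0 6).
  by apply/hasP; exists s => //; rewrite mem_iota.
have f6 : (sector v < 6)%N by rewrite /sector -[X in (_ < X)%N](size_iota 0) -has_find.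
apply: (@closed_sector_inj _ _ v) => //; last exact: in_sector_closed.
by have := nth_find 0%N hh; rewrite nth_iota.
Qed.

Lemma in_sector_sector v : (sector v < 6)%N -> in_sector (sector v) v.
Proof.
move=> f6; have hh : has (in_sector^~ v) (iota 0 6) by rewrite has_find size_iota.
by have := nth_find 0%N hh; rewrite nth_iota.
Qed.

Definition opp_sector s : nat := (s + 3) %% 6.

Lemma opp_sectorK s : (s < 6)%N -> opp_sector (opp_sector s) = s.
Proof. by case: s => [|[|[|[|[|[|]]]]]]. Qed.

Lemma opp_sector_lt s : (opp_sector s < 6)%N.
Proof. exact: ltn_pmod. Qed.

Lemma opp_sector_neq s : (s < 6)%N -> opp_sector s != s.
Proof. by case: s => [|[|[|[|[|[|]]]]]]. Qed.

Lemma sectorN v : (sector v < 6)%N -> sector (- v) = opp_sector (sector v).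
Proof.
move=> f6; apply: sectorE; first exact: opp_sector_lt.
have := in_sector_sector f6; case: v f6 => x y.
case: (sector _) => [|[|[|[|[|[|//]]]]]] _;
  rewrite /in_sector /= => /andP[h1 h2]; apply/andP; split; lra.
Qed.

(* [p] lies on the counterclockwise way from [s] to [t]; this way has at most
   three steps, since the corners of a triangle are smaller than pi. *)
Definition between (s t p : nat) : bool :=
  ((p + 6 - s) %% 6 <= (t + 6 - s) %% 6 <= 3)%N.

Lemma hexrotD u v : hexrot (u + v) = hexrot u + hexrot v.
Proof. by rewrite /hexrot; congr pair => /=; ring. Qed.

Lemma iter_hexrotD s u v : iter s hexrot (u + v) = iter s hexrot u + iter s hexrot v.
Proof. by elim: s => //= s ->; rewrite hexrotD. Qed.

Definition vscale (k : R) v : R * R := (k * v.1, k * v.2).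

Lemma iter_hexrotZ s k v : iter s hexrot (vscale k v) = vscale k (iter s hexrot v).
Proof. by elim: s => //= s ->; rewrite /hexrot /vscale /=; congr pair; ring. Qed.

(** Finitely many strict inequalities survive a small perturbation; each pair holds a value and its
    rate of change. *)
Lemma small_shift (l : seq (R * R)) : all (fun q => 0 < q.1) l ->
  exists2 k : R, 0 < k & all (fun q => 0 < q.1 + k * q.2) l.
Proof.
elim: l => [|[x d] l IH] /=; first by exists 1.
case/andP=> x0 /[dup] hl /IH[k k0 hk].
have n0 : 0 < `|d| + 1 by rewrite ltr_wpDl.
exists (Num.min k (x / (`|d| + 1))).
  by rewrite lt_min k0 divr_gt0.
set m := Num.min _ _.
have m0 : 0 < m by rewrite lt_min k0 divr_gt0.
have mk : m <= k by rewrite ge_min lexx.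
have mx : m * (`|d| + 1) <= x by rewrite -ler_pdivlMr // ge_min lexx orbT.
apply/andP; split.
  have := ler_norm (- d); rewrite normrN; nra.
apply/allP => q ql; have := allP hk q ql; have := allP hl q ql => /= h1 h2.
case: (lerP 0 q.2) => h; first by nra.
nra.
Qed.

(** If [p] is the sector of [u] or [v], that vector is tilted slightly towards the other one.
    Otherwise sector [p] lies strictly inside the corner and its bisector works. *)
Lemma sector_direction s t p u v :
  (p < 6)%N -> in_sector s u -> in_sector t v -> (s < 6)%N -> (t < 6)%N ->
  0 < det u v -> between s t p ->
  opp_sector p != s -> opp_sector p != t ->
  exists d, [/\ in_sector p d, 0 < det u d & 0 < det d v].
Proof.
move=> p6 su tv s6 t6 duv bt.
have [->{p p6 bt} _ _|ps] := eqVneq p s.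
  have /andP[h1 h2] := su.
  have [|k k0] := @small_shift [:: ((iter s hexrot u).1, (iter s hexrot v).1);
    ((iter s hexrot u).2, (iter s hexrot v).2)]; first by rewrite /= h1 h2.
  rewrite /= andbT => /andP[h3 h4]; exists (u + vscale k v); split.
  - by rewrite /in_sector iter_hexrotD iter_hexrotZ h3.
  - have -> : det u (u + vscale k v) = k * det u v by rewrite /det /=; ring.
    exact: mulr_gt0.
  - by have -> : det (u + vscale k v) v = det u v by rewrite /det /=; ring.
have [->{p p6 bt ps} _ _|pt] := eqVneq p t.
  have /andP[h1 h2] := tv.
  have [|k k0] := @small_shift [:: ((iter t hexrot v).1, (iter t hexrot u).1);
    ((iter t hexrot v).2, (iter t hexrot u).2)]; first by rewrite /= h1 h2.
  rewrite /= andbT => /andP[h3 h4]; exists (v + vscale k u); split.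
  - by rewrite /in_sector iter_hexrotD iter_hexrotZ h3.
  - by have -> : det u (v + vscale k u) = det u v by rewrite /det /=; ring.
  - have -> : det (v + vscale k u) v = k * det u v by rewrite /det /=; ring.
    exact: mulr_gt0.
move=> os ot.
(* The vector (1, 1) bisects sector 0, and [6 - p] clockwise turns amount to [p] counterclockwise
   ones. *)
pose d := iter (6 - p) hexrot (1, 1).
have [x [y xy]] : exists x y, u = (x, y) by exists u.1, u.2; case: (u).
have [x' [y' xy']] : exists x y, v = (x, y) by exists v.1, v.2; case: (v).
exists d; subst u v; rewrite /d /det; clear d duv.
case: p p6 ps pt os ot bt => [|[|[|[|[|[|//]]]]]] _;
case: s su s6 => [|[|[|[|[|[|//]]]]]] + _;
case: t tv t6 => [|[|[|[|[|[|//]]]]]] + _ //;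
rewrite /in_sector /= => /andP[? ?] /andP[? ?] _ _ _ _ _; split; try (apply/andP; split); lra.
Qed.

End Sectors.

(** * Types of faces *)

(* The type of a face with counterclockwise vertices a, b, c consists of the
   sectors [i], [j], [k] of ab, bc, ca, and of sectors [pa], [pb], [pc]: all
   edges drawn later inside the corner at a must leave a in the sector [pa],
   and likewise for b and c. *)
Definition corner_ok (s t p : nat) : bool :=
  [&& between s t p, opp_sector p != s & opp_sector p != t].

(* A new vertex close to a sees b and c as a does: it can be joined to them
   within the prescribed sectors if these contain ba and ca. *)
Definition near_first (i j k pa pb pc : nat) : bool :=
  (pb == opp_sector i) && (pc == k).

(* The types from which the construction can be continued forever. The
   distinctness of the prescribed sectors comes from an exhaustive search: it is
   what makes the class closed under subdivision. *)
Definition good (i j k pa pb pc : nat) : bool :=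
  [&& corner_ok i (opp_sector k) pa, corner_ok j (opp_sector i) pb,
      corner_ok k (opp_sector j) pc, uniq [:: pa; pb; pc]
    & [|| near_first i j k pa pb pc, near_first j k i pb pc pa
        | near_first k i j pc pa pb]].

(* [x], [y], [z] are the sectors prescribed at the new vertex v in the faces abv,
   bcv, cav; as v sees a in the sector opposite to [pa], the last two conditions
   say that they are not opposite to an edge at v nor to each other. *)
Definition splits (i j k pa pb pc x y z : nat) : bool :=
  [&& good i pb (opp_sector pa) pa pb x,
      good j pc (opp_sector pb) pb pc y,
      good k pa (opp_sector pc) pc pa z,
      ~~ has (mem [:: pa; pb; pc]) [:: x; y; z]
    & ~~ has (mem (map opp_sector [:: x; y; z])) [:: x; y; z]].

Lemma good_rot i j k pa pb pc : good i j k pa pb pc -> good j k i pb pc pa.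
Proof.
case/and5P=> h1 h2 h3 h4 h5; rewrite /good h1 h2 h3 /=; apply/andP; split.
  by rewrite -(rot_uniq 1) /= in h4.
by case/or3P: h5 => ->; rewrite ?orbT.
Qed.

Lemma good_splits i j k pa pb pc :
  (i < 6)%N -> (j < 6)%N -> (k < 6)%N -> (pa < 6)%N -> (pb < 6)%N -> (pc < 6)%N ->
  good i j k pa pb pc -> near_first i j k pa pb pc ->
  exists q : nat * nat * nat,
   [/\ (q.1.1 < 6)%N, (q.1.2 < 6)%N, (q.2 < 6)%N
     & splits i j k pa pb pc q.1.1 q.1.2 q.2].
Proof.
pose l := iota 0 6.
(* Conditionals spare the search on types outside the hypotheses, where boolean connectives would be
   evaluated strictly. *)
have H : all (fun i => all (fun j => all (fun k => all (fun pa => all (fun pb =>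
    all (fun pc =>
      if good i j k pa pb pc then if near_first i j k pa pb pc then
        has (fun x => has (fun y => has (splits i j k pa pb pc x y) l) l) l
      else true else true) l) l) l) l) l) l by vm_compute.
have L n : (n < 6)%N -> n \in l by rewrite mem_iota.
move=> /L hi /L hj /L hk /L ha /L hb /L hc hg hn.
move/allP/(_ _ hi)/allP/(_ _ hj)/allP/(_ _ hk)/allP/(_ _ ha): H.
move/allP/(_ _ hb)/allP/(_ _ hc); rewrite hg hn.
case/hasP=> x hx /hasP[y hy] /hasP[z hz] hs; exists (x, y, z) => /=.
by rewrite !mem_iota in hx hy hz.
Qed.

Lemma det_rot (R : realFieldType) (A B C : R * R) :
  det (C - B) (A - B) = det (B - A) (C - A).
Proof. by rewrite /det /=; ring. Qed.

(** The point is [A] moved by [h] times a direction [d] of sector [pa] inside the corner. For small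
    [h] it stays in the triangle, and [B] and [C] see it almost as they see [A], hence in the same
    open sectors. *)
Lemma place_near_corner (R : realFieldType) (A B C : R * R) (pa : nat) :
  let i := sector (B - A) in let k := sector (A - C) in
  0 < det (B - A) (C - A) -> (i < 6)%N -> (k < 6)%N -> (pa < 6)%N ->
  corner_ok i (opp_sector k) pa ->
  exists l : R * R * R, exists y : R * R,
   [/\ [/\ 0 < l.1.1, 0 < l.1.2, 0 < l.2 & l.1.1 + l.1.2 + l.2 = 1],
       y.1 = l.1.1 * A.1 + l.1.2 * B.1 + l.2 * C.1,
       y.2 = l.1.1 * A.2 + l.1.2 * B.2 + l.2 * C.2
     & [/\ sector (y - A) = pa, sector (y - B) = opp_sector i & sector (y - C) = k]].
Proof.
move=> i k D0 i6 k6 pa6 /and3P[bt o1 o2].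
have sAB : in_sector i (B - A) by apply: in_sector_sector.
have sCA : in_sector k (A - C) by apply: in_sector_sector.
have kE : sector (C - A) = opp_sector k by rewrite -opprB sectorN.
have iE : sector (A - B) = opp_sector i by rewrite -opprB sectorN.
have sAC : in_sector (opp_sector k) (C - A).
  by rewrite -kE; apply: in_sector_sector; rewrite kE opp_sector_lt.
have sBA : in_sector (opp_sector i) (A - B).
  by rewrite -iE; apply: in_sector_sector; rewrite iE opp_sector_lt.
have [|d [sd d1 d2]] := sector_direction pa6 sAB sAC i6 _ D0 bt o1 o2.
  exact: opp_sector_lt.
set D := det _ _ in D0.
(* Cramer's rule for [d] in the basis [B - A], [C - A]. *)
pose m1 := det d (C - A) / D; pose m2 := det (B - A) d / D.
have m10 : 0 < m1 by rewrite divr_gt0.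
have m20 : 0 < m2 by rewrite divr_gt0.
have Dn : D != 0 by rewrite gt_eqF.
have dE1 : d.1 = m1 * (B - A).1 + m2 * (C - A).1.
  have H : d.1 * D = det d (C - A) * (B - A).1 + det (B - A) d * (C - A).1.
    by rewrite /D /det /=; ring.
  by rewrite -[LHS](mulfK Dn) H /m1 /m2; ring.
have dE2 : d.2 = m1 * (B - A).2 + m2 * (C - A).2.
  have H : d.2 * D = det d (C - A) * (B - A).2 + det (B - A) d * (C - A).2.
    by rewrite /D /det /=; ring.
  by rewrite -[LHS](mulfK Dn) H /m1 /m2; ring.
clearbody m1 m2; pose c1 s (u : R * R) := (iter s (@hexrot R) u).1.
pose c2 s (u : R * R) := (iter s (@hexrot R) u).2.
have /andP[u1 u2] := sBA; have /andP[v1 v2] := sCA.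
(* The first entry keeps the weight of [A] positive, the others keep the directions from [B] and [C]
   in their sectors. *)
have [|h h0] := @small_shift R [:: (1, - (m1 + m2));
   (c1 (opp_sector i) (A - B), c1 (opp_sector i) d);
   (c2 (opp_sector i) (A - B), c2 (opp_sector i) d);
   (c1 k (A - C), c1 k d); (c2 k (A - C), c2 k d)].
  by rewrite /= ltr01 u1 u2 v1 v2.
rewrite /= andbT => /and5P[w0 w1 w2 w3 w4].
exists (1 - h * (m1 + m2), h * m1, h * m2), (A + vscale h d) => /=; split.
- split; [lra | exact: mulr_gt0 | exact: mulr_gt0 | ring].
- by rewrite dE1 /=; ring.
- by rewrite dE2 /=; ring.
- have shift s X : c1 s (A - X + vscale h d) = c1 s (A - X) + h * c1 s d
      /\ c2 s (A - X + vscale h d) = c2 s (A - X) + h * c2 s d.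
    by rewrite /c1 /c2 iter_hexrotD iter_hexrotZ.
  split; apply: sectorE; rewrite ?opp_sector_lt //.
  + rewrite addrC addKr /in_sector iter_hexrotZ /=.
    by case/andP: sd => ? ?; rewrite !mulr_gt0.
  + rewrite addrAC; have [e1 e2] := shift (opp_sector i) B.
    by rewrite /in_sector -/(c1 _ _) -/(c2 _ _) e1 e2 w1.
  + rewrite addrAC; have [e1 e2] := shift k C.
    by rewrite /in_sector -/(c1 _ _) -/(c2 _ _) e1 e2 w3.
Qed.

(** * Straight drawings and their stellar subdivisions *)

Section Drawing.
Variables (R : realFieldType) (V : finType) (e : rel V).
Hypotheses (e_sym : symmetric e) (e_irr : irreflexive e).

Definition corner : Type := (V * nat)%type.
Definition face : Type := (corner * corner * corner)%type.

Implicit Types (phi : V -> R * R) (S K : {set V}) (F : face -> Prop)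
  (w : V -> R) (a b c : corner).

Definition face_set (f : face) : {set V} := [set f.1.1.1; f.1.2.1; f.2.1].

Definition is_face F K : Prop := exists2 f, F f & face_set f = K.

Definition is_corner F a : Prop := exists b c, F (a, b, c).

Definition dir phi (x y : V) : nat := sector (phi y - phi x).

Definition support w : {set V} := [set x | w x != 0].

(** A triangle of the graph is filled only while it is a face; once subdivided, it keeps only its
    boundary. *)
Definition simplex S F K : Prop :=
  [/\ K \subset S, clique e K, (#|K| <= 3)%N & #|K| = 3%N -> is_face F K].

(** Points of the geometric realisation of the complex, in barycentric coordinates. *)
Definition bary S F w : Prop :=
  [/\ forall x, 0 <= w x, \sum_x w x = 1 & simplex S F (support w)].

Definition same_point phi w w' : Prop :=
  \sum_x w x * (phi x).1 = \sum_x w' x * (phi x).1 /\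
  \sum_x w x * (phi x).2 = \sum_x w' x * (phi x).2.

Definition proper S phi a b c : Prop :=
  [/\ [/\ a.1 \in S, b.1 \in S & c.1 \in S],
      [/\ e a.1 b.1, e b.1 c.1 & e c.1 a.1],
      [/\ (a.2 < 6)%N, (b.2 < 6)%N & (c.2 < 6)%N],
      0 < det (phi b.1 - phi a.1) (phi c.1 - phi a.1)
    & good (dir phi a.1 b.1) (dir phi b.1 c.1) (dir phi c.1 a.1) a.2 b.2 c.2].

(* A straight drawing of the graph induced by [S], with faces [F]. By
   [drawn_free] and [drawn_corners], an edge drawn later in a prescribed sector
   continues no edge at its old end, whence [drawn_turn] is preserved. Planarity
   is [drawn_inj]: the complex of the vertices, edges and faces is embedded. *)
Record drawn S phi F : Prop := {
  drawn_rot : forall a b c, F (a, b, c) -> F (b, c, a) ;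
  drawn_face : forall a b c, F (a, b, c) -> proper S phi a b c ;
  drawn_dir : {in S &, forall x y, e x y -> (dir phi x y < 6)%N} ;
  drawn_turn : {in S & &, forall x y z, e x y -> e y z ->
    dir phi x y = dir phi y z -> e x z} ;
  drawn_free : forall a x, is_corner F a -> x \in S -> e x a.1 ->
    dir phi x a.1 != a.2 ;
  drawn_corners : forall x p q, is_corner F (x, p) -> is_corner F (x, q) ->
    opp_sector p != q ;
  drawn_inj : forall w w', bary S F w -> bary S F w' -> same_point phi w w' ->
    w =1 w' }.

Lemma dirC phi x y : (dir phi x y < 6)%N -> dir phi y x = opp_sector (dir phi x y).
Proof. by move=> h; rewrite /dir -[RHS]sectorN // opprB. Qed.

(* Writing [phi v] as a barycentre of [K] sends weights on the subdivided
   complex to weights on the old one; this map is injective since the former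
   never charge all of [K]. *)
Lemma stellar_inj S F F' phi phi' v K (l : V -> R) :
  (forall w w', bary S F w -> bary S F w' -> same_point phi w w' -> w =1 w') ->
  v \notin S -> {in S, phi =1 phi'} ->
  is_face F K -> K \subset S -> clique e K -> #|K| = 3%N ->
  {in S, forall x, e v x = (x \in K)} ->
  {in K, forall x, 0 < l x} -> (forall x, x \notin K -> l x = 0) -> \sum_x l x = 1 ->
  \sum_x l x * (phi x).1 = (phi' v).1 -> \sum_x l x * (phi x).2 = (phi' v).2 ->
  ~ is_face F' K ->
  (forall L, is_face F' L -> v \notin L -> is_face F L) ->
  forall w w', bary (v |: S) F' w -> bary (v |: S) F' w' ->
    same_point phi' w w' -> w =1 w'.
Proof.
move=> inj vS eqp fK KS cK K3 evK lpos l0 l1 lx ly nfK oldF.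
have vK : v \notin K by apply/negP => /(subsetP KS); apply/negP.
pose push w x := if x == v then 0 else w x + w v * l x.
have lge0 x : 0 <= l x by case: (boolP (x \in K)) => [/lpos/ltW|/l0 ->].
have zero w : bary (v |: S) F' w -> exists2 u, u \in K & w u = 0.
  case=> w0 w1 [sS cl sle sf].
  have [/subsetP KsubW|] := boolP (K \subset support w); last first.
    by case/subsetPn => u uK; rewrite inE negbK => /eqP; exists u.
  have KE : K = support w.
    by apply/eqP; rewrite eqEcard K3 sle andbT; apply/subsetP.
  by case: nfK; rewrite KE; apply: sf; rewrite -KE.
have pushb w : bary (v |: S) F' w -> bary S F (push w).
  case=> w0 w1 [sS cl sle sf]; split.
  - by move=> x; rewrite /push; case: ifP => // _; rewrite addr_ge0 // mulr_ge0.
  - rewrite (bigD1 v) //= {1}/push eqxx add0r.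
    transitivity (\sum_(i | i != v) (w i + w v * l i)).
      by apply: eq_bigr => i /negbTE iv; rewrite /push iv.
    rewrite big_split /= -mulr_sumr.
    have -> : \sum_(i | i != v) l i = 1.
      by rewrite -l1 [in RHS](bigD1 v) //= l0 // add0r.
    by rewrite mulr1 addrC -w1 [RHS](bigD1 v).
  - have [wv|wv] := eqVneq (w v) 0.
      have pE x : push w x = w x.
        by rewrite /push wv mul0r addr0; case: eqP => // ->.
      have -> : support (push w) = support w by apply/setP => x; rewrite !inE pE.
      have vs : v \notin support w by rewrite inE wv eqxx.
      split=> //; last by move=> s3; apply: oldF => //; apply: sf.
      apply/subsetP => x xs; have := subsetP sS x xs; rewrite !inE => /orP[/eqP xv|//].
      by rewrite xv (negbTE vs) in xs.
    (* The rest of the support consists of neighbours of [v], all in [K], and the weight pushed from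
       [v] fills [K]. *)
    suff -> : support (push w) = K by split=> //; rewrite K3.
    have vs : v \in support w by rewrite inE.
    apply/setP => x; rewrite inE /push; have [->|xv] := eqVneq x v.
      by rewrite eqxx (negbTE vK).
    have wv0 : 0 < w v by rewrite lt0r wv w0.
    have [xK|xK] := boolP (x \in K).
      have := lpos x xK; have := w0 x => h1 h2.
      by rewrite gt_eqF // ltr_wpDl // mulr_gt0.
    rewrite l0 // mulr0 addr0; apply/negbTE; rewrite negbK.
    apply: contraNT xK => wx; have xs : x \in support w by rewrite inE.
    have := subsetP sS x xs; rewrite !inE (negbTE xv) /= => xS.
    by rewrite -evK //; apply: cl; rewrite // eq_sym.
have pushp w (g : R * R -> R) : bary (v |: S) F' w ->
    \sum_x l x * g (phi x) = g (phi' v) ->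
    \sum_x push w x * g (phi x) = \sum_x w x * g (phi' x).
  case=> w0 w1 [sS cl sle sf] lg.
  rewrite (bigD1 v) //= {1}/push eqxx mul0r add0r.
  rewrite [RHS](bigD1 v) //= -lg (bigD1 v (F := fun x => l x * _)) //= l0 //.
  rewrite mul0r add0r mulr_sumr -big_split /=; apply: eq_bigr => x xv.
  rewrite /push (negbTE xv) mulrDl mulrA addrC; congr (_ + _).
  have [xS|xS] := boolP (x \in S); first by rewrite eqp.
  suff -> : w x = 0 by rewrite !mul0r.
  apply/eqP; apply: contraNT xS => wx.
  by have := subsetP sS x; rewrite !inE wx (negbTE xv) => /(_ isT).
move=> w w' bw bw' [e1 e2].
have E : push w =1 push w'.
  apply: inj; [exact: pushb | exact: pushb|].
  by split; rewrite !(pushp _ (fun q => _ q)).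
have E' u : u != v -> w u + w v * l u = w' u + w' v * l u.
  by move=> uv; have := E u; rewrite /push (negbTE uv).
(* At a vertex of [K] where [w1] vanishes, the pushed weight of [w1] comes from [v] alone; this
   bounds [w2 v]. *)
have le w1 w2 : bary (v |: S) F' w1 -> bary (v |: S) F' w2 ->
   (forall u, u != v -> w1 u + w1 v * l u = w2 u + w2 v * l u) -> w2 v <= w1 v.
  move=> b1 b2 h; have [u uK u0] := zero _ b1.
  have uv : u != v by apply: contraNneq vK => <-.
  have := h u uv; rewrite u0 add0r => hh.
  case: b2 => /(_ u) w20 _ _; have := lpos u uK => lu.
  rewrite leNgt; apply/negP => hlt.
  have : w1 v * l u < w2 v * l u by rewrite ltr_pM2r.
  lra.
have vE : w v = w' v.
  apply/eqP; rewrite eq_le !le // => u uv; by rewrite E'.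
move=> u; have [->//|uv] := eqVneq u v.
by have := E' u uv; rewrite vE => /addIr.
Qed.


Lemma proper_rot S phi a b c : proper S phi a b c -> proper S phi b c a.
Proof.
case=> -[? ? ?] [? ? ?] [? ? ?] D0 /good_rot g; split=> //.
by rewrite det_rot.
Qed.

Lemma face_set_rot a b c : face_set (b, c, a) = face_set (a, b, c).
Proof. by rewrite /face_set /= [RHS]setUC setUA [in RHS]setUC -setUA setUC -setUA setUC -setUA. Qed.

Lemma good_corner i j k pa pb pc :
  good i j k pa pb pc -> corner_ok i (opp_sector k) pa.
Proof. by case/and5P. Qed.

Definition rot_closure (g f : face) : Prop :=
  let: (a, b, c) := f in
  [\/ g = (a, b, c), g = (b, c, a) | g = (c, a, b)].

Lemma face_set_closure g f : rot_closure g f -> face_set g = face_set f.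
Proof.
case: f => -[a b] c [] ->; first by [].
  by rewrite face_set_rot.
by rewrite (face_set_rot b c a) face_set_rot.
Qed.

(** The face is replaced by three, whose prescribed sectors at [v] come from [good_splits]; the
    corners at [a], [b], [c] keep theirs. The last two conclusions track which triangles remain or
    become faces. *)
Lemma drawn_step S phi F v a b c :
  drawn S phi F -> v \notin S -> F (a, b, c) ->
  {in S, forall x, e v x = (x \in face_set (a, b, c))} ->
  near_first (dir phi a.1 b.1) (dir phi b.1 c.1) (dir phi c.1 a.1) a.2 b.2 c.2 ->
  exists phi' F', [/\ drawn (v |: S) phi' F',
    forall K, is_face F K -> K != face_set (a, b, c) -> is_face F' K
    & {in face_set (a, b, c) &, forall x y, x != y -> is_face F' [set v; x; y]}].
Proof.
move=> dr vS Fabc ev nearP.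
have [[aS bS cS] [eab ebc eca] [pa6 pb6 pc6] D0 gd] := drawn_face dr Fabc.
have i6 := drawn_dir dr aS bS eab; have j6 := drawn_dir dr bS cS ebc.
have k6 := drawn_dir dr cS aS eca.
have [[[x y] z] /= [x6 y6 z6 /and5P[g1 g2 g3 n1 n2]]] :=
  good_splits i6 j6 k6 pa6 pb6 pc6 gd nearP.
move: nearP => /andP[/eqP nb /eqP nc].
have [[[l1 l2] l3] /= [yv [[l10 l20 l30 lsum] yv1 yv2 [sa sb sc]]]] :=
  place_near_corner D0 i6 k6 pa6 (good_corner gd).
pose phi' u := if u == v then yv else phi u.
have phiS u : u \in S -> phi' u = phi u.
  by rewrite /phi'; case: eqP => // -> vS'; rewrite vS' in vS.
have phiv : phi' v = yv by rewrite /phi' eqxx.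
have dirS : {in S &, forall u u', dir phi' u u' = dir phi u u'}.
  by move=> u u' uS u'S; rewrite /dir !phiS.
have dav : dir phi' a.1 v = a.2 by rewrite /dir phiv phiS.
(* By [near_first], the sectors prescribed at [b] and [c] are those in which they see [a], and so
   also [v]. *)
have dbv : dir phi' b.1 v = b.2 by rewrite /dir phiv phiS // sb nb.
have dcv : dir phi' c.1 v = c.2 by rewrite /dir phiv phiS // sc nc.
have inK u : (u \in face_set (a, b, c)) = [|| u == a.1, u == b.1 | u == c.1].
  by rewrite !inE orbA.
have fin u : u \in S -> e v u -> exists p, [/\ is_corner F (u, p), dir phi' u v = p,
    (p < 6)%N & p \in [:: a.2; b.2; c.2]].
  move=> uS; rewrite ev // inK => /or3P[] /eqP ->.
  - by exists a.2; split; rewrite // ?inE ?eqxx // -surjective_pairing; exists b, c.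
  - exists b.2; split; rewrite // ?inE ?eqxx ?orbT // -surjective_pairing.
    by exists c, a; apply: (drawn_rot dr).
  - exists c.2; split; rewrite // ?inE ?eqxx ?orbT // -surjective_pairing.
    by exists a, b; do 2 apply: (drawn_rot dr).
have dirv u : u \in S -> e v u -> (dir phi' u v < 6)%N.
  by move=> uS /(fin u uS)[p [_ -> ->]].
have eva : e v a.1 by rewrite ev // inK eqxx.
have evb : e v b.1 by rewrite ev // inK eqxx orbT.
have evc : e v c.1 by rewrite ev // inK eqxx !orbT.
pose f1 : face := (a, b, (v, x)); pose f2 : face := (b, c, (v, y)).
pose f3 : face := (c, a, (v, z)).
pose F' (g : face) := (F g /\ face_set g != face_set (a, b, c)) \/
  [\/ rot_closure g f1, rot_closure g f2 | rot_closure g f3].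
have Sv : S \subset v |: S by apply: subsetUr.
have sub u : u \in S -> u \in v |: S by apply: subsetP.
have vv : v \in v |: S by rewrite setU11.
have P1 : proper (v |: S) phi' a b (v, x).
  split=> //=; [by split=> //; apply: sub|by split=> //; rewrite e_sym|..].
  (* Moving a corner to [v] multiplies the area by the weight of that corner. *)
  - rewrite phiv !phiS // [X in 0 < X](_ : _ = l3 * det (phi b.1 - phi a.1) (phi c.1 - phi a.1)).
      exact: mulr_gt0.
    by rewrite /det /= yv1 yv2; (have -> : l1 = 1 - l2 - l3 by lra); ring.
  - by rewrite (dirC (dirv _ aS eva)) dav dbv dirS.
have P2 : proper (v |: S) phi' b c (v, y).
  split=> //=; [by split=> //; apply: sub|by split=> //; rewrite e_sym|..].
  - rewrite phiv !phiS // [X in 0 < X](_ : _ = l1 * det (phi b.1 - phi a.1) (phi c.1 - phi a.1)).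
      exact: mulr_gt0.
    by rewrite /det /= yv1 yv2; (have -> : l1 = 1 - l2 - l3 by lra); ring.
  - by rewrite (dirC (dirv _ bS evb)) dbv dcv dirS.
have P3 : proper (v |: S) phi' c a (v, z).
  split=> //=; [by split=> //; apply: sub|by split=> //; rewrite e_sym|..].
  - rewrite phiv !phiS // [X in 0 < X](_ : _ = l2 * det (phi b.1 - phi a.1) (phi c.1 - phi a.1)).
      exact: mulr_gt0.
    by rewrite /det /= yv1 yv2; (have -> : l1 = 1 - l2 - l3 by lra); ring.
  - by rewrite (dirC (dirv _ cS evc)) dcv dav dirS.
have cornerF' u p : is_corner F' (u, p) ->
    (u \in S /\ is_corner F (u, p)) \/ (u = v /\ p \in [:: x; y; z]).
  have ca : is_corner F a by exists b, c.
  have cb : is_corner F b by exists c, a; apply: (drawn_rot dr).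
  have cc : is_corner F c by exists a, b; do 2 apply: (drawn_rot dr).
  have old q : q.1 \in S -> is_corner F q -> (u, p) = q ->
     (u \in S /\ is_corner F (u, p)) \/ (u = v /\ p \in [:: x; y; z]).
    by move=> qS cq h; rewrite h in cq *; left; split=> //; rewrite -h in qS.
  have new q : q \in [:: x; y; z] -> (u, p) = (v, q) ->
     (u \in S /\ is_corner F (u, p)) \/ (u = v /\ p \in [:: x; y; z]).
    by move=> hq [-> ->]; right.
  case=> b' [c' [[Fg _]|]].
    have [[uS _ _] _ _ _ _] := drawn_face dr Fg.
    by left; split=> //; exists b', c'.
  have [hx hy hz] : [/\ x \in [:: x; y; z], y \in [:: x; y; z] & z \in [:: x; y; z]].
    by rewrite !inE !eqxx !orbT.
  have oa := old _ aS ca; have ob := old _ bS cb; have oc := old _ cS cc.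
  by case=> -[] /(congr1 (fun g : face => g.1.1)) /=;
    do ?[exact: oa | exact: ob | exact: oc | exact: new].
exists phi', F'; split.
- split.
  + move=> a' b' c' [[Fg nE]|h].
      left; split; first exact: (drawn_rot dr).
      by rewrite face_set_rot.
    right; case: h => -[] [-> -> ->]; [constructor 1|constructor 1|constructor 1|
      constructor 2|constructor 2|constructor 2|constructor 3|constructor 3|constructor 3];
    by [constructor 1|constructor 2|constructor 3].
  + move=> a' b' c' [[Fg _]|].
      have [[? ? ?] [? ? ?] [? ? ?] ? ?] := drawn_face dr Fg.
      by split; rewrite ?sub // ?dirS // !phiS.
    by case=> -[] [-> -> ->]; do ?[exact: P1|exact: P2|exact: P3|apply: proper_rot].
  + move=> u u'; rewrite !in_setU1 => /orP[/eqP ->|uS] /orP[/eqP ->|u'S].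
    * by rewrite e_irr.
    * by move=> evu; rewrite (dirC (dirv _ u'S evu)) opp_sector_lt.
    * by rewrite e_sym; apply: dirv.
    * by rewrite dirS //; apply: (drawn_dir dr).
  + move=> u u' u''; rewrite !in_setU1.
    move=> /orP[/eqP ->|uS] /orP[/eqP ->|u'S] /orP[/eqP ->|u''S]; rewrite ?e_irr //.
    * move=> evu _; rewrite (dirC (dirv _ u'S evu)) => h.
      by have := opp_sector_neq (dirv _ u'S evu); rewrite h eqxx.
    (* Alignment is impossible here: the edge from [u''] would reach [u'] in the sector prescribed
       there, against [drawn_free]. *)
    * move=> evu' eu; rewrite (dirC (dirv _ u'S evu')) (dirS _ _ u'S u''S) => h.
      have [p [cp dp p6 _]] := fin _ u'S evu'.
      rewrite e_sym in eu.
      have := drawn_free dr cp u''S eu.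
      rewrite /= (dirC (_ : (dir phi u' u'' < 6)%N)); last first.
        by apply: (drawn_dir dr); rewrite // e_sym.
      by rewrite -h dp opp_sectorK // eqxx.
    (* Two edges at [v] may be aligned, but their other ends are corners of the subdivided face,
       hence adjacent. *)
    * rewrite ![e _ v]e_sym => evu evu'' h.
      have [ue|ue] := eqVneq u u''.
        rewrite {}ue in evu h *.
        rewrite (dirC (dirv _ u''S evu'')) in h.
        by have := opp_sector_neq (dirv _ u''S evu''); rewrite -h eqxx.
      move: evu evu'' ue; rewrite !ev // !inK.
      by case/or3P=> /eqP -> /or3P[] /eqP ->; rewrite ?eqxx // e_sym.
    * rewrite [e u' v]e_sym => eu evu' h.
      have [p [cp dp p6 _]] := fin _ u'S evu'.
      by have := drawn_free dr cp uS eu; rewrite /= -dp -h dirS // eqxx.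
    * by move=> eu eu' h; apply: (drawn_turn dr uS u'S u''S) => //; rewrite -!dirS.
  + move=> [u p] u' /cornerF' /= [[uS cu]|[-> pin]]; rewrite in_setU1.
      case/orP=> [/eqP ->|u'S eu]; last by rewrite dirS //; apply: (drawn_free dr cu).
      move=> evu; have [q [cq dq q6 _]] := fin _ uS evu.
      by rewrite (dirC (dirv _ uS evu)) dq; apply: (drawn_corners dr cq cu).
    (* Edges arrive at [v] in the sectors prescribed at their old ends, which [x], [y], [z] avoid by
       [n1]. *)
    case/orP=> [/eqP ->|u'S]; first by rewrite e_irr.
    rewrite e_sym => evu; have [q [cq dq q6 qin]] := fin _ u'S evu.
    rewrite dq; apply: contraNneq n1 => qp; apply/hasP; exists p => //.
    by rewrite -qp.
  + move=> u p q /cornerF' [[uS cu]|[uv pin]] /cornerF' [[uS' cu']|[uv' qin]].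
    * exact: (drawn_corners dr cu cu').
    * by rewrite uv' (negbTE vS) in uS.
    * by rewrite uv (negbTE vS) in uS'.
    * apply: contraNneq n2 => opq; apply/hasP; exists q => //.
      by rewrite -opq; apply: map_f.
  + pose l u := if u == a.1 then l1 else if u == b.1 then l2 else if u == c.1 then l3 else 0.
    have ab : a.1 != b.1 by apply: contraTneq eab => ->; rewrite e_irr.
    have bc : b.1 != c.1 by apply: contraTneq ebc => ->; rewrite e_irr.
    have ca : c.1 != a.1 by apply: contraTneq eca => ->; rewrite e_irr.
    have lsumE (g : V -> R) : \sum_u l u * g u = l1 * g a.1 + l2 * g b.1 + l3 * g c.1.
      rewrite (bigD1 a.1) //= (bigD1 b.1) 1?eq_sym //= (bigD1 c.1) /=; last first.
        by rewrite ca eq_sym.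
      rewrite big1 => [|u /andP[/andP[/negbTE h1 /negbTE h2] /negbTE h3]].
        rewrite /l !eqxx [b.1 == _]eq_sym (negbTE ab) (negbTE ca).
        by rewrite [c.1 == _]eq_sym (negbTE bc) addr0 !addrA.
      by rewrite /l h1 h2 h3 mul0r.
    apply: (@stellar_inj S F F' phi phi' v (face_set (a, b, c)) l).
    * exact: (drawn_inj dr).
    * by [].
    * by move=> u uS; rewrite phiS.
    * by exists (a, b, c).
    * by apply/subsetP => u; rewrite inK => /or3P[] /eqP ->.
    * move=> u u'; rewrite !inK => /or3P[] /eqP -> /or3P[] /eqP ->; rewrite ?eqxx // => _;
        by rewrite e_sym.
    * by rewrite /face_set /= setUC cardsU1 cards2 ab !inE (negbTE ca) eq_sym (negbTE bc).
    * exact: ev.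
    * by move=> u; rewrite inK /l; do 3 (case: ifP => //).
    * by move=> u; rewrite inK /l; do 3 (case: ifP => //).
    * have := lsumE (fun=> 1); rewrite !mulr1 lsum => <-.
      by apply: eq_bigr => u _; rewrite mulr1.
    * by rewrite lsumE phiv yv1.
    * by rewrite lsumE phiv yv2.
    * case=> g [[_ /eqP //]|h] gE.
      have : v \in face_set g.
        by case: h => /face_set_closure ->; rewrite !inE eqxx orbT.
      rewrite gE inK => /or3P[] /eqP vE; by rewrite vE ?aS ?bS ?cS in vS.
    * move=> L [g [[Fg _]|h] gE] vL; first by exists g.
      move: vL; rewrite -gE; case: h => /face_set_closure ->; by rewrite !inE eqxx orbT.
- by move=> K [g Fg gK] nK; exists g => //; left; rewrite gK.
- have s1 : face_set f1 = [set v; a.1; b.1] by rewrite /face_set /= setUC setUA.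
  have s2 : face_set f2 = [set v; b.1; c.1] by rewrite /face_set /= setUC setUA.
  have s3 : face_set f3 = [set v; c.1; a.1] by rewrite /face_set /= setUC setUA.
  have sw u u' : [set v; u; u'] = [set v; u'; u] by rewrite setUAC.
  have i1 : is_face F' [set v; a.1; b.1] by exists f1 => //; right; constructor 1; constructor 1.
  have i2 : is_face F' [set v; b.1; c.1] by exists f2 => //; right; constructor 2; constructor 1.
  have i3 : is_face F' [set v; c.1; a.1] by exists f3 => //; right; constructor 3; constructor 1.
  move=> u u'; rewrite !inK => /or3P[] /eqP -> /or3P[] /eqP ->; rewrite ?eqxx // => _.
  + by rewrite sw.
  + by rewrite sw.
  + by rewrite sw.
Qed.

End Drawing.

(** * Construction sequences of 3-trees *)

Section Construction.
Variables (R : realFieldType) (V : finType) (e : rel V).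
Hypotheses (e_sym : symmetric e) (e_irr : irreflexive e).

Implicit Types (S K L : {set V}).

Lemma card_setD1 K x n : x \in K -> #|K| = n.+1 -> #|K :\ x| = n.
Proof. by move=> xK; rewrite (cardsD1 x) xK => -[]. Qed.

Lemma cards3P K : reflect (exists x y z, [/\ x != y, y != z, z != x & K = [set x; y; z]])
  (#|K| == 3%N).
Proof.
apply: (iffP idP) => [/eqP K3|[x [y [z [xy yz zx ->]]]]]; last first.
  by rewrite setUC cardsU1 cards2 xy !inE (negbTE zx) [z == y]eq_sym (negbTE yz).
have /set0Pn[x xK] : K != set0 by rewrite -card_gt0 K3.
have /eqP K2 := card_setD1 xK K3.
have [y [z [yz KE]]] := cards2P _ K2; exists x, y, z.
have yK : y \in K :\ x by rewrite KE !inE eqxx.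
have zK : z \in K :\ x by rewrite KE !inE eqxx orbT.
rewrite !inE in yK zK; case/andP: yK => yx _; case/andP: zK => zx _.
by split; rewrite // 1?eq_sym // -setUA -KE setD1K.
Qed.

(** By [good], some rotation of the face satisfies [near_first]; it decides near which corner [v]
    goes. *)
Lemma drawn_insert S (phi : V -> R * R) F v K :
  drawn e S phi F -> v \notin S -> is_face F K -> {in S, forall x, e v x = (x \in K)} ->
  exists (phi' : V -> R * R) F', [/\ drawn e (v |: S) phi' F',
    forall L, is_face F L -> L != K -> is_face F' L
    & {in K &, forall x y, x != y -> is_face F' [set v; x; y]}].
Proof.
move=> dr vS [[[a b] c] Fabc <-] ev.
have [_ _ _ _ gd] := drawn_face dr Fabc.
have Fbca := drawn_rot dr Fabc; have Fcab := drawn_rot dr Fbca.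
case/and5P: gd => _ _ _ _ /or3P[] nr.
- exact: (drawn_step e_sym e_irr dr vS Fabc ev nr).
- rewrite -(face_set_rot a b c) in ev *.
  exact: (drawn_step e_sym e_irr dr vS Fbca ev nr).
- rewrite -(face_set_rot a b c) -(face_set_rot b c a) in ev *.
  exact: (drawn_step e_sym e_irr dr vS Fcab ev nr).
Qed.

Lemma drawn_base K : clique e K -> #|K| = 3%N ->
  exists (phi : V -> R * R) F, drawn e K phi F /\ is_face F K.
Proof.
move=> cK /eqP/cards3P[a [b [c [ab bc ca KE]]]]; rewrite {K}KE in cK *.
have aK : a \in [set a; b; c] by rewrite !inE eqxx.
have bK : b \in [set a; b; c] by rewrite !inE eqxx orbT.
have cK' : c \in [set a; b; c] by rewrite !inE eqxx !orbT.
have eab : e a b by apply: cK.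
have ebc : e b c by apply: cK.
have eca : e c a by apply: cK.
pose phi u : R * R := if u == a then (0, 0) else if u == b then (2, 1) else (-1, 2).
have pa : phi a = (0, 0) by rewrite /phi eqxx.
have pb : phi b = (2, 1) by rewrite /phi eq_sym (negbTE ab) eqxx.
have pc : phi c = (-1, 2) by rewrite /phi (negbTE ca) eq_sym (negbTE bc).
have dab : dir phi a b = 0%N.
  by rewrite /dir pa pb; apply: sectorE => //; rewrite /in_sector /=; apply/andP; split; lra.
have dbc : dir phi b c = 2%N.
  by rewrite /dir pb pc; apply: sectorE => //; rewrite /in_sector /=; apply/andP; split; lra.
have dca : dir phi c a = 4%N.
  by rewrite /dir pc pa; apply: sectorE => //; rewrite /in_sector /=; apply/andP; split; lra.
have dba : dir phi b a = 3%N by rewrite dirC dab.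
have dcb : dir phi c b = 5%N by rewrite dirC dbc.
have dac : dir phi a c = 1%N by rewrite dirC dca.
have dirE := (dab, dbc, dca, dba, dcb, dac).
(* This type is good through its second corner: the first vertex inserted goes near [b]. *)
pose f : face V := ((a, 0%N), (b, 2%N), (c, 5%N)).
have prop : proper e [set a; b; c] phi (a, 0%N) (b, 2%N) (c, 5%N).
  split=> //=; last by rewrite !dirE.
  by rewrite pa pb pc /det /=; lra.
have inK u : u \in [set a; b; c] -> [\/ u = a, u = b | u = c].
  by rewrite !inE -orbA => /or3P[] /eqP ->; [constructor 1|constructor 2|constructor 3].
have cornerE x p : is_corner (fun g => rot_closure g f) (x, p) ->
    [\/ (x = a /\ p = 0%N), (x = b /\ p = 2%N) | (x = c /\ p = 5%N)].
  by case=> b' [c' [] [-> -> _ _]]; [constructor 1|constructor 2|constructor 3].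
exists phi, (fun g => rot_closure g f); split; last by exists f => //; constructor 1.
split.
- by move=> a' b' c' [] [-> -> ->]; [constructor 2|constructor 3|constructor 1].
- by move=> a' b' c' [] [-> -> ->]; do ?[exact: prop|apply: proper_rot].
- by move=> x y /inK[] -> /inK[] ->; rewrite ?e_irr // !dirE.
- move=> x y z /inK[] -> /inK[] -> /inK[] ->; rewrite ?e_irr // ?dirE //.
- by move=> [u p] x /cornerE[] [-> ->] /inK[] ->; rewrite ?e_irr // !dirE.
- move=> x p q /cornerE[] [-> ->] /cornerE[] [h ->] //.
  + by rewrite h eqxx in bc.
  + by rewrite h eqxx in bc.
move=> w w' [w0 w1 [sS _ _ _]] [w0' w1' [sS' _ _ _]] [e1 e2].
have sumE (g : V -> R) (k : V -> R) : support g \subset [set a; b; c] ->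
    \sum_u g u * k u = g a * k a + g b * k b + g c * k c.
  move=> sg; rewrite (bigD1 a) //= (bigD1 b) 1?eq_sym //= (bigD1 c) /=; last first.
    by rewrite ca eq_sym.
  rewrite big1 => [|u /andP[/andP[/negbTE h1 /negbTE h2] /negbTE h3]].
    by rewrite addr0 !addrA.
  have : u \notin support g.
    by apply/negP => /(subsetP sg); rewrite !inE h1 h2 h3.
  by rewrite inE negbK => /eqP ->; rewrite mul0r.
have one (g : V -> R) : support g \subset [set a; b; c] -> \sum_u g u = g a + g b + g c.
  move=> sg; have := sumE g (fun=> 1) sg; rewrite !mulr1 => <-.
  by apply: eq_bigr => u _; rewrite mulr1.
rewrite !sumE // pa pb pc /= in e1 e2; rewrite !one // in w1 w1'.
have [ha hb hc] : [/\ w a = w' a, w b = w' b & w c = w' c] by split; lra.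
move=> u; have [/inK[] -> //|uK] := boolP (u \in [set a; b; c]).
have zero (g : V -> R) : support g \subset [set a; b; c] -> g u = 0.
  by move=> sg; apply/eqP; apply: contraNT uK => gu; apply: (subsetP sg); rewrite inE.
by rewrite !zero.
Qed.

(** Starting from a triangle rather than a K_4 leaves the choice of the outer face free. *)
Inductive built K0 : {set V} -> Prop :=
| built_triangle : built K0 K0
| built_add S K v : built K0 S -> v \notin S -> K \subset S -> #|K| = 3%N ->
    clique e K -> {in S, forall x, e v x = (x \in K)} -> built K0 (v |: S).

Lemma cliqueS K L : L \subset K -> clique e K -> clique e L.
Proof. by move=> /subsetP s cK x y /s xK /s yK; apply: cK. Qed.

Lemma clique_add K v : clique e K -> {in K, forall x, e v x} -> clique e (v |: K).
Proof.
move=> cK h x y; rewrite !in_setU1 => /orP[/eqP ->|xK] /orP[/eqP ->|yK].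
- by rewrite eqxx.
- by move=> _; apply: h.
- by move=> _; rewrite e_sym; apply: h.
- exact: cK.
Qed.

(** If the last vertex [v] is in [K], its neighbourhood [K0] shares two vertices with [K], so [K0]
    with [v] is also [K] with one vertex [z]. After [K] and [z], the construction from [K0] can be
    followed. *)
Lemma built_reroot S K : three_tree_on e S -> K \subset S -> #|K| = 3%N ->
  clique e K -> built K S.
Proof.
move=> tt; elim: tt K => {S} [S S4 cS|S K0 v _ IH vS K0S K03 cK0 ev] K KS K3 cK.
  have /cards1P[v SKv] : #|S :\: K| == 1%N by rewrite cardsD (setIidPr KS) S4 K3.
  have vSK : v \in S :\: K by rewrite SKv set11.
  move: (vSK); rewrite inE => /andP[vK vS].
  have -> : S = v |: K by rewrite -[LHS](setID S K) (setIidPr KS) SKv setUC.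
  apply: (@built_add K K K) => //; first exact: built_triangle.
  move=> x xK; rewrite xK; apply: cS => //; first exact: (subsetP KS).
  by apply: contraNneq vK => ->.
have [vK|vK] := boolP (v \in K); last first.
  apply: (@built_add K S K0) => //; apply: IH => //.
  apply/subsetP => x xK; have := subsetP KS x xK.
  by rewrite in_setU1 => /orP[/eqP xv|//]; rewrite -xv xK in vK.
have KvK0 : K :\ v \subset K0.
  apply/subsetP => x; rewrite !inE => /andP[xv xK].
  have := subsetP KS x xK; rewrite in_setU1 (negbTE xv) /= => xS.
  by rewrite -ev //; apply: cK; rewrite // eq_sym.
have Kv2 := card_setD1 vK K3.
have vK0 : v \notin K0 by apply/negP => /(subsetP K0S); apply/negP.
have /cards1P[z zE] : #|K0 :\: (K :\ v)| == 1%N by rewrite cardsD (setIidPr KvK0) K03 Kv2.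
have : z \in K0 :\: (K :\ v) by rewrite zE set11.
rewrite inE => /andP[zK zK0].
have zv : z != v by apply: contraNneq vK0 => <-.
have zK' : z \notin K by move: zK; rewrite !inE zv.
have K0E : K0 = z |: (K :\ v).
  by rewrite -[LHS](setID K0 (K :\ v)) (setIidPr KvK0) zE setUC.
have baseE : v |: K0 = z |: K by rewrite K0E setUCA setD1K.
have base : built K (v |: K0).
  rewrite baseE; apply: (@built_add K K K) => //; first exact: built_triangle.
  move=> x xK; rewrite xK; have [->|xv] := eqVneq x v.
    by rewrite e_sym ev //; apply: (subsetP K0S).
  have xK0 : x \in K0 by rewrite K0E !inE xv xK orbT.
  by apply: cK0 => //; apply: contraNneq zK' => ->.
have : built K0 S by apply: IH.
have : S \subset S by [].
(* The sequence from [K0] is replayed with [v] already present; its added vertices lie outside [K0],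
   so none is adjacent to [v]. *)
move: {1 3 4}S => S' S'S bS'; elim: bS' S'S => {S'} [|S' K1 u bS' IH' uS' K1S K13 cK1 eu] uS.
  by [].
have S'S : S' \subset S by apply: subset_trans uS; apply: subsetUr.
have uS1 : u \in S by apply: (subsetP uS); rewrite setU11.
have uv : u != v by apply: contraNneq vS => <-.
have K0S' : K0 \subset S'.
  elim: bS' {IH' S'S K1S uS eu uS'} => // *.
  by apply: subset_trans (subsetUr _ _).
rewrite setUCA; apply: (@built_add K (v |: S') K1) => //.
- exact: IH'.
- by rewrite in_setU1 negb_or uv.
- by apply: subset_trans K1S (subsetUr _ _).
- move=> x; rewrite in_setU1 => /orP[/eqP ->|xS']; last exact: eu.
  have -> : v \in K1 = false.
    by apply/negP => /(subsetP K1S)/(subsetP S'S); apply/negP.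
  by rewrite e_sym ev //; apply/negbTE; apply/negP => /(subsetP K0S'); apply/negP.
Qed.

(** * Common neighbours of triangles *)

Definition common S K : {set V} := [set x in S | [forall y in K, e x y]].

Lemma commonS S S' K : S \subset S' -> common S K \subset common S' K.
Proof. by move=> s; apply/subsetP => x; rewrite !inE => /andP[/(subsetP s) -> ->]. Qed.

Lemma commonP S K x : reflect (x \in S /\ {in K, forall y, e x y}) (x \in common S K).
Proof. by rewrite inE; apply: (iffP andP) => -[? /forall_inP]. Qed.

Lemma triangle_new S K v L : {in S, forall x, e v x = (x \in K)} -> v \in L ->
  L \subset v |: S -> #|L| = 3%N -> clique e L ->
  exists x y, [/\ x \in K, y \in K, x != y & L = [set v; x; y]].
Proof.
move=> ev vL LS L3 cL.
have /eqP Lv := card_setD1 vL L3.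
have [x [y [xy LE]]] := cards2P _ Lv.
have H u : u \in L :\ v -> u \in K.
  rewrite !inE => /andP[uv uL]; have := subsetP LS u uL.
  by rewrite in_setU1 (negbTE uv) /= => uS; rewrite -ev //; apply: cL; rewrite // eq_sym.
exists x, y; split=> //; try by apply: H; rewrite LE !inE eqxx ?orbT.
by rewrite -setUA -LE setD1K.
Qed.

Lemma common_new S K v : v \notin S -> K \subset S -> {in S, forall x, e v x = (x \in K)} ->
  #|common (v |: S) K| = #|common S K|.+1.
Proof.
move=> vS KS ev.
have -> : common (v |: S) K = v |: common S K.
  apply/setP => x; rewrite !inE; have [->|//] := eqVneq x v.
  by apply/forall_inP => y yK; rewrite ev //; apply: (subsetP KS).
by rewrite cardsU1 inE (negbTE vS).
Qed.

Lemma third_element K x y : #|K| = 3%N -> x \in K -> y \in K ->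
  exists2 z, z \in K & (z != x) && (z != y).
Proof.
move=> K3 xK yK; have : (0 < #|K :\: [set x; y]|)%N.
  rewrite cardsD subn_gt0 K3 (leq_ltn_trans (subset_leq_card (subsetIr _ _))) //.
  by rewrite cards2; case: eqP.
by case/card_gt0P => z; rewrite !inE negb_or => /andP[h zK]; exists z.
Qed.

(** A triangle through the newest vertex has its two other vertices in [K], and the third vertex of
    [K] is a common neighbour. *)
Lemma built_common K0 S L : built K0 S -> #|K0| = 3%N ->
  L \subset S -> #|L| = 3%N -> clique e L -> (1 <= #|common S L| + (L == K0))%N.
Proof.
move=> bS K03; elim: bS L => {S} [|S K v _ IH vS KS K3 cK ev] L LS L3 cL.
  have -> : L = K0 by apply/eqP; rewrite eqEcard LS L3 K03.
  by rewrite eqxx addn1.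
have [vL|vL] := boolP (v \in L); last first.
  apply: (leq_trans (IH L _ L3 cL)).
    apply/subsetP => x xL; have := subsetP LS x xL.
    by rewrite in_setU1 => /orP[/eqP xv|//]; rewrite -xv xL in vL.
  by rewrite leq_add2r subset_leq_card // commonS // subsetUr.
have [x [y [xK yK xy ->]]] := triangle_new ev vL LS L3 cL.
have [z zK /andP[zx zy]] := third_element K3 xK yK.
rewrite addn_gt0; apply/orP; left; apply/card_gt0P; exists z.
apply/commonP; split; first by rewrite in_setU1 (subsetP KS) ?orbT.
move=> u; rewrite !inE => /orP[/orP[]|] /eqP ->; try exact: cK.
by rewrite e_sym ev //; apply: (subsetP KS).
Qed.

(* A triangle with two common neighbours among the vertices present is no
   longer a face, and gets no third one; the outer triangle [K0] is counted as
   if it had one common neighbour outside. *)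
Lemma built_drawn K0 S : built K0 S -> clique e K0 -> #|K0| = 3%N ->
  (forall K, K \subset S -> #|K| = 3%N -> (#|common S K| + (K == K0) <= 2)%N) ->
  exists (phi : V -> R * R) F, drawn e S phi F /\
    (forall K, K \subset S -> #|K| = 3%N -> clique e K ->
      is_face F K \/ (2 <= #|common S K| + (K == K0))%N).
Proof.
move=> bS cK0 K03; elim: bS => {S} [|S K v bS IH vS KS K3 cK ev] few.
  have [phi [F [dr fK0]]] := drawn_base cK0 K03; exists phi, F; split=> // K KK0 K3 _.
  by left; have -> : K = K0 by apply/eqP; rewrite eqEcard KK0 K3 K03.
have SvS : S \subset v |: S by apply: subsetUr.
have mono L : (#|common S L| + (L == K0) <= #|common (v |: S) L| + (L == K0))%N.
  by rewrite leq_add2r subset_leq_card // commonS.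
have [|phi [F [dr faces]]] := IH.
  move=> L LS L3; apply: leq_trans (few L _ L3) => //; exact: subset_trans SvS.
have cn := common_new vS KS ev.
(* Otherwise [v] would raise the count of [K] to three. *)
have fK : is_face F K.
  have [//|] := faces K KS K3 cK; have := few K (subset_trans KS SvS) K3.
  by rewrite cn addSn => h1 h2; have := leq_trans h2 h1; rewrite ltnn.
have [phi' [F' [dr' old new]]] := drawn_insert dr vS fK ev.
exists phi', F'; split=> // L LS L3 cL.
have [vL|vL] := boolP (v \in L).
  by left; have [x [y [xK yK xy ->]]] := triangle_new ev vL LS L3 cL; apply: new.
have LS' : L \subset S.
  apply/subsetP => x xL; have := subsetP LS x xL.
  by rewrite in_setU1 => /orP[/eqP xv|//]; rewrite -xv xL in vL.
have [fL|h] := faces L LS' L3 cL; last by right; apply: leq_trans (mono L).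
(* The subdivided triangle stops being a face, but [v] brings its count to two. *)
have [LK|LK] := eqVneq L K; last by left; apply: old.
by right; rewrite LK cn addSn; apply: built_common bS _ _ _ _; rewrite // -LK.
Qed.

(* The last vertex added lies on a triangle with a single common neighbour:
   this is a face, and it can serve as the outer one. *)
Lemma outer_triangle S : three_tree_on e S ->
  exists K, [/\ K \subset S, #|K| = 3%N, clique e K & (#|common S K| <= 1)%N].
Proof.
have key S' K v : v \notin S' -> K \subset S' -> #|K| = 3%N -> clique e K ->
    {in S', forall x, e v x = (x \in K)} ->
    exists L, [/\ L \subset v |: S', #|L| = 3%N, clique e L & (#|common (v |: S') L| <= 1)%N].
  move=> vS KS /[dup] K3 /eqP/cards3P[x [y [z [xy yz zx KE]]]] cK ev.
  have [xK yK] : x \in K /\ y \in K by rewrite KE !inE !eqxx orbT.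
  have sK : [set x; y] \subset K by apply/subsetP => u; rewrite !inE => /orP[] /eqP ->.
  have vL : v \notin [set x; y] by apply/negP => /(subsetP sK)/(subsetP KS); apply/negP.
  exists (v |: [set x; y]); split.
  - by apply: setUS; apply: subset_trans KS.
  - by rewrite cardsU1 vL cards2 xy.
  - apply: clique_add; first exact: cliqueS cK.
    by move=> u /(subsetP sK) uK; rewrite ev // (subsetP KS).
  (* A common neighbour is adjacent to [v], hence in [K], and differs from [x] and [y]. *)
  - rewrite -(cards1 z); apply: subset_leq_card; apply/subsetP => u /commonP[uS h].
    have ux : u != x by apply/eqP => ux; have := h x; rewrite ux e_irr !inE eqxx orbT => /(_ isT).
    have uy : u != y by apply/eqP => uy; have := h y; rewrite uy e_irr !inE eqxx !orbT => /(_ isT).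
    have uv : e v u by rewrite e_sym h // setU11.
    move: uS; rewrite in_setU1 => /orP[/eqP uv'|uS]; first by rewrite uv' e_irr in uv.
    by move: uv; rewrite ev // KE !inE (negbTE ux) (negbTE uy).
case=> {S} [S S4 cS|S K v _ vS KS K3 cK ev]; last exact: (key S K v).
have /card_gt0P[v vS] : (0 < #|S|)%N by rewrite S4.
have KS : S :\ v \subset S by apply: subD1set.
rewrite -(setD1K vS); apply: (key _ (S :\ v) v) => //.
- by rewrite setD11.
- exact: card_setD1 vS S4.
- exact: cliqueS cS.
- move=> x xS; rewrite xS; apply: cS => //; first exact: (subsetP KS).
  by move: xS; rewrite !inE eq_sym => /andP[].
Qed.

Lemma three_tree_drawn : three_tree e ->
  (forall K, #|K| = 3%N -> (#|common setT K| <= 2)%N) ->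
  exists (phi : V -> R * R) F, drawn e setT phi F.
Proof.
move=> tt few; have [K0 [K0S K03 cK0 c1]] := outer_triangle tt.
have [|phi [F [dr _]]] := built_drawn (built_reroot tt K0S K03 cK0) cK0 K03; last by exists phi, F.
move=> K _ K3; have [->|_] := eqVneq K K0; last by rewrite addn0 few.
by rewrite addn1.
Qed.

End Construction.

(** * Nonplanarity of K_{3,3} *)

Section RayCrossing.
Variable R : realFieldType.
Implicit Types z : R * R.

(** Half-open, so that exactly one of [z] and [- z] is upper when [z] is nonzero. *)
Definition upper z : bool := (0 < z.2) || (z.2 == 0) && (0 < z.1).

(* Meaningful only when [z1] and [z2] lie in a common open half plane: the
   step then crosses the ray from the origin towards the right. *)
Definition crossing z1 z2 : bool := (upper z1 (+) upper z2) && (0 < z1.1).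

Definition half_plane (k : bool * bool) z : bool :=
  let x := if k.1 then z.1 else z.2 in if k.2 then 0 < x else x < 0.

Lemma upper_half k z : ~~ k.1 -> half_plane k z -> upper z = k.2.
Proof.
case: k => -[] // -[] _; rewrite /half_plane /upper /=; first by move=> ->.
by move=> h; rewrite lt_eqF // ltNge ltW.
Qed.

Lemma crossing_half k z1 z2 : half_plane k z1 -> half_plane k z2 ->
  crossing z1 z2 = [&& k.1, k.2 & upper z1 (+) upper z2].
Proof.
move=> h1 h2; rewrite /crossing; case: k h1 h2 => -[] l h1 h2 /=; last first.
  by rewrite !(upper_half _ h1, upper_half _ h2) // addbb.
rewrite andbC; congr (_ && _); move: h1; rewrite /half_plane /=.
by case: l {h2} => // h; rewrite ltNge ltW.
Qed.

Lemma upperN z : z != 0 -> upper (- z) = ~~ upper z.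
Proof.
case: z => x y; rewrite -pair_eqE /= /upper /= !oppr_gt0 oppr_eq0.
by case: (ltgtP y 0); case: (ltgtP x 0).
Qed.

Lemma half_plane_neq0 k z : half_plane k z -> z != 0.
Proof. by apply: contraTneq => ->; case: k => -[] []; rewrite /half_plane /= ltxx. Qed.

(** Crossing the right ray with [- z] is crossing the left ray with [z]; both rays together form the
    horizontal axis. *)
Lemma crossingN k z1 z2 : half_plane k z1 -> half_plane k z2 ->
  crossing z1 z2 (+) crossing (- z1) (- z2) = upper z1 (+) upper z2.
Proof.
move=> h1 h2; have n1 := half_plane_neq0 h1; have n2 := half_plane_neq0 h2.
have N z : half_plane k z -> half_plane (k.1, ~~ k.2) (- z).
  by case: k {h1 h2} => -[] [] /=; rewrite /half_plane /= ?oppr_gt0 ?oppr_lt0.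
rewrite (crossing_half h1 h2) (crossing_half (N _ h1) (N _ h2)) !upperN //.
case: k h1 h2 {N} => -[] l h1 h2 /=; last by rewrite !(upper_half _ h1, upper_half _ h2) // addbb.
by case: l {h1 h2}; case: (upper z1); case: (upper z2).
Qed.

(** Within one half plane the crossings are the changes of a function of the position, so they
    cancel around a cell. *)
Lemma crossing_cell k z00 z01 z10 z11 : half_plane k z00 -> half_plane k z01 ->
  half_plane k z10 -> half_plane k z11 ->
  crossing z00 z10 (+) crossing z01 z11 = crossing z00 z01 (+) crossing z10 z11.
Proof.
move=> h00 h01 h10 h11; rewrite (crossing_half h00 h10) (crossing_half h01 h11).
rewrite (crossing_half h00 h01) (crossing_half h10 h11).
by case: k.1; case: k.2; case: (upper z00); case: (upper z01); case: (upper z10);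
  case: (upper z11).
Qed.

Fixpoint crossings (z : nat -> R * R) (n : nat) : bool :=
  if n is m.+1 then crossings z m (+) crossing (z m) (z m.+1) else false.

(** A discrete Stokes formula: in the sum over all cells the inner edges cancel. *)
Lemma crossings_grid (z : nat -> nat -> R * R) n m :
  (forall i j, (i < n)%N -> (j < m)%N -> exists k,
     [&& half_plane k (z i j), half_plane k (z i j.+1), half_plane k (z i.+1 j)
       & half_plane k (z i.+1 j.+1)]) ->
  crossings (z ^~ 0%N) n (+) crossings (z ^~ m) n =
  crossings (z 0%N) m (+) crossings (z n) m.
Proof.
elim: m n => [|m IH] n cell; first by rewrite addbb.
have IHm : crossings (z ^~ 0%N) n (+) crossings (z ^~ m) n =
    crossings (z 0%N) m (+) crossings (z n) m.
  by apply: IH => i j hi hj; apply: cell; rewrite // ltnS ltnW.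
have row : crossings (z ^~ m) n (+) crossings (z ^~ m.+1) n =
    crossing (z 0%N m) (z 0%N m.+1) (+) crossing (z n m) (z n m.+1).
  have {IH IHm}: forall i, (i < n)%N -> exists k,
     [&& half_plane k (z i m), half_plane k (z i m.+1), half_plane k (z i.+1 m)
       & half_plane k (z i.+1 m.+1)] by move=> i hi; apply: cell.
  elim: n {cell} => [|n IH] cell; first by rewrite /= addbb.
  have [k /and4P[h00 h01 h10 h11]] := cell n (ltnSn n).
  rewrite /= [LHS]addbACA IH => [|i hi]; last by apply: cell; rewrite ltnS ltnW.
  rewrite (crossing_cell h00 h01 h10 h11).
  by case: (crossing (z n m) _); case: (crossing (z n.+1 m) _);
    case: (crossing (z 0%N m) _).
rewrite /= [RHS]addbACA -IHm -row.
by case: (crossings (z^~ 0%N) n); case: (crossings (z^~ m) n); case: (crossings (z^~ m.+1) n).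
Qed.

Lemma crossingsN (z : nat -> R * R) n :
  (forall i, (i < n)%N -> exists k, half_plane k (z i) && half_plane k (z i.+1)) ->
  crossings z n (+) crossings (fun i => - z i) n = upper (z 0%N) (+) upper (z n).
Proof.
elim: n => [|n IH] h; first by rewrite addbb.
have [k /andP[h1 h2]] := h n (ltnSn n).
rewrite /= addbACA IH => [|i hi]; last by apply: h; rewrite ltnS ltnW.
by rewrite (crossingN h1 h2) addbA -[X in X (+) _]addbA addbb addbF.
Qed.

End RayCrossing.

(** * Ray crossings of two disjoint curves *)

Section Nonplanar.
Variable R : realType.
Implicit Types p q : R -> R * R.

Lemma curve_near p s : curve p -> 0 <= s <= 1 -> forall d : R, 0 < d ->
  exists2 h : R, 0 < h & forall s' : R, 0 <= s' <= 1 -> `|s' - s| < h ->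
    `|(p s').1 - (p s).1| < d /\ `|(p s').2 - (p s).2| < d.
Proof.
move=> cp s01 d d0.
have sI : `[0, 1]%classic s by rewrite /= in_itv.
have := (iffLR (subspace_continuousP _ _) cp) s sI.
move=> /cvg_ballP/(_ d d0); rewrite near_withinE => /nbhs_ballP[h h0 H].
exists h => // s' s'01 hs; have := H s'; rewrite /ball /= distrC => /(_ hs).
by rewrite in_itv /= => /(_ s'01)[]; rewrite /ball /= [`|(p s).1 - _|]distrC [`|(p s).2 - _|]distrC.
Qed.

Lemma near_half_plane p q s t : curve p -> curve q -> 0 <= s <= 1 -> 0 <= t <= 1 ->
  p s != q t -> exists k, exists2 h : R, 0 < h & forall s' t' : R,
    0 <= s' <= 1 -> 0 <= t' <= 1 -> `|s' - s| < h -> `|t' - t| < h ->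
    half_plane k (p s' - q t').
Proof.
move=> cp cq s01 t01 pq.
have [k hk] : exists k, half_plane k (p s - q t).
  move: pq; rewrite -subr_eq0; case: (p s - q t) => x y.
  rewrite -pair_eqE /= negb_and => /orP[] /lt_total/orP[] h.
  - by exists (true, false).
  - by exists (true, true).
  - by exists (false, false).
  - by exists (false, true).
exists k; pose x z : R := if k.1 then z.1 else z.2.
have d0 : 0 < `|x (p s - q t)| / 2.
  rewrite divr_gt0 // normr_gt0; move: hk; rewrite /half_plane -/(x _).
  by case: k.2 => [/lt0r_neq0|/ltr0_neq0].
have [h1 h10 H1] := curve_near cp s01 d0; have [h2 h20 H2] := curve_near cq t01 d0.
exists (Num.min h1 h2); first by rewrite lt_min h10.
move=> s' t' s'01 t'01; rewrite !lt_min => /andP[hs _] /andP[_ ht].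
have [a1 a2] := H1 s' s'01 hs; have [b1 b2] := H2 t' t'01 ht.
move: hk; rewrite /half_plane -/(x _).
move: a1 a2 b1 b2; rewrite /x; case: k.1 => /= a1 a2 b1 b2; case: k.2 => h;
  move: a1 a2 b1 b2; rewrite ?(gtr0_norm h) ?(ltr0_norm h) !ltr_norml;
  move=> /andP[? ?] /andP[? ?] /andP[? ?] /andP[? ?]; lra.
Qed.

(** Compactness of the square makes the mesh in [near_half_plane] uniform. *)
Lemma grid_half_plane p q : curve p -> curve q ->
  (forall s t : R, 0 <= s <= 1 -> 0 <= t <= 1 -> p s != q t) ->
  \forall n \near \oo%classic, forall s t : R, 0 <= s <= 1 -> 0 <= t <= 1 ->
   exists k, forall s' t' : R, 0 <= s' <= 1 -> 0 <= t' <= 1 ->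
    `|s' - s| <= n.+1%:R^-1 -> `|t' - t| <= n.+1%:R^-1 -> half_plane k (p s' - q t').
Proof.
move=> cp cq pq.
pose P n (st : R * R) := exists k, forall s' t' : R, 0 <= s' <= 1 -> 0 <= t' <= 1 ->
  `|s' - st.1| <= n.+1%:R^-1 -> `|t' - st.2| <= n.+1%:R^-1 -> half_plane k (p s' - q t').
have cK : compact (`[0, 1]%classic `*` `[0, 1]%classic : set (R * R)).
  by apply: compact_setX; apply: segment_compact.
have /near_covering_withinP nc := iffLR (compact_near_coveringP _) cK.
have H : \forall n \near \oo%classic,
    ((`[0, 1]%classic `*` `[0, 1]%classic : set (R * R)) `<=` P n)%classic.
  apply: nc => -[s t] [] /=; rewrite !in_itv /= => s01 t01.
  have [k [h h0 hk]] := near_half_plane cp cq s01 t01 (pq s t s01 t01).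
  have h20 : 0 < h / 2 by rewrite divr_gt0.
  exists (ball (s, t) (h / 2), [set n : nat | n.+1%:R^-1 < h / 2]%classic).
    split; first exact: nbhsx_ballx.
    exact: (near_infty_natSinv_lt (PosNum h20)).
  move=> [[s1 t1] n] /= [[b1 b2] hn] _; exists k => s' t' s'01 t'01 hs ht.
  move: b1 b2; rewrite /ball /= => b1 b2.
  apply: hk => //.
    apply: le_lt_trans (ler_distD s1 _ _) _; rewrite [ltRHS]splitr ltrD //.
      exact: le_lt_trans hs hn.
    by rewrite distrC.
  apply: le_lt_trans (ler_distD t1 _ _) _; rewrite [ltRHS]splitr ltrD //.
    exact: le_lt_trans ht hn.
  by rewrite distrC.
apply: filterS H => n H s t s01 t01.
by have := H (s, t); apply; split; rewrite /= in_itv.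
Qed.

Definition sampled p n (i : nat) : R * R := p (i%:R / n.+1%:R).

(** For a fine mesh, the parity of the crossings of [p] with the ray from [v] to the right. *)
Definition ray_parity n p (v : R * R) : bool :=
  crossings (fun i => sampled p n i - v) n.+1.

(** The grid formula is applied to [p s - q t]. On two sides of the square [q] moves and the vector
    has the wrong sign; [crossingsN] reverses it at the cost of the terms in [upper]. *)
Lemma disjoint_crossings p q : curve p -> curve q ->
  (forall s t : R, 0 <= s <= 1 -> 0 <= t <= 1 -> p s != q t) ->
  \forall n \near \oo%classic,
   (ray_parity n p (q 0) (+) ray_parity n p (q 1)) (+)
   (ray_parity n q (p 0) (+) ray_parity n q (p 1)) =
   (upper (p 0 - q 0) (+) upper (p 0 - q 1)) (+)
   (upper (p 1 - q 0) (+) upper (p 1 - q 1)).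
Proof.
move=> cp cq pq; have := grid_half_plane cp cq pq; apply: filterS => n H.
have n0 : (0 : R) < n.+1%:R by rewrite ltr0n.
have mem i : (i <= n.+1)%N -> 0 <= (i%:R / n.+1%:R : R) <= 1.
  by move=> h; rewrite divr_ge0 //= ler_pdivrMr // mul1r ler_nat.
have nearS i : `|i.+1%:R / n.+1%:R - i%:R / n.+1%:R : R| <= n.+1%:R^-1.
  by rewrite -mulrBl -natrB ?leqnSn // subSnn mul1r ger0_norm // invr_ge0.
have near0 (x : R) : `|x - x| <= n.+1%:R^-1.
  by rewrite subrr normr0 invr_ge0.
pose z i j := sampled p n i - sampled q n j.
have cell i j : (i < n.+1)%N -> (j < n.+1)%N -> exists k,
     [&& half_plane k (z i j), half_plane k (z i j.+1), half_plane k (z i.+1 j)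
       & half_plane k (z i.+1 j.+1)].
  move=> hi hj; have [k hk] := H _ _ (mem i (ltnW hi)) (mem j (ltnW hj)).
  by exists k; rewrite !hk // ?mem // ltnW.
have s0 r : sampled r n 0 = r 0 by rewrite /sampled mul0r.
have s1 r : sampled r n n.+1 = r 1 by rewrite /sampled divff // gt_eqF.
have := crossings_grid cell.
have col i : (i <= n.+1)%N -> crossings (z i) n.+1 (+) ray_parity n q (sampled p n i) =
    upper (z i 0%N) (+) upper (z i n.+1).
  move=> hi; rewrite -crossingsN; last first.
    move=> j hj; have [k hk] := H _ _ (mem i hi) (mem j (ltnW hj)).
    by exists k; rewrite !hk // ?mem // ltnW.
  by congr (_ (+) crossings _ _); apply/funext => j; rewrite /z opprB.
have := col 0%N isT; have := col n.+1 (leqnn _).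
rewrite /z !s0 !s1 -/(ray_parity n p _) -/(ray_parity n p _) => <- <- ->.
by rewrite addbACA [X in X (+) _]addbC [X in _ (+) X]addbC.
Qed.

End Nonplanar.

(** * The parity count over K_{3,3} *)

Section K33.

Definition sum6 (T : Type) (i0 i1 i2 : T) (X : T -> T -> bool) : bool :=
  (X i0 i1 (+) X i1 i0) (+) (X i0 i2 (+) X i2 i0) (+) (X i1 i2 (+) X i2 i1).

(** In the sum of the six relations each term with a single index occurs twice and [g] six times,
    while [G] contributes 1 for each of the three unordered pairs. *)
Lemma sum6_parity (T : Type) (i0 i1 i2 : T) (A B u w : T -> bool) (g : bool)
    (X Y G : T -> T -> bool) :
  let rel j l := (A j (+) X j l) (+) (B l (+) Y l j) =
                 (g (+) u l) (+) (w j (+) G j l) in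
  rel i0 i1 -> rel i1 i0 -> rel i0 i2 -> rel i2 i0 -> rel i1 i2 -> rel i2 i1 ->
  G i1 i0 = ~~ G i0 i1 -> G i2 i0 = ~~ G i0 i2 -> G i2 i1 = ~~ G i1 i2 ->
  sum6 i0 i1 i2 X (+) sum6 i0 i1 i2 Y = true.
Proof.
move=> rel r01 r10 r02 r20 r12 r21 g01 g02 g12.
have solve a b x y k u' w' h : (a (+) x) (+) (b (+) y) = (k (+) u') (+) (w' (+) h) ->
    x (+) y = (a (+) w') (+) (b (+) u') (+) (k (+) h).
  by case: a; case: b; case: x; case: y; case: k; case: u'; case: w'; case: h.
have pair j l : rel j l -> rel l j -> G l j = ~~ G j l ->
    (X j l (+) X l j) (+) (Y j l (+) Y l j) =
    ~~ ((A j (+) w j) (+) (B j (+) u j) (+) ((A l (+) w l) (+) (B l (+) u l))).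
  move=> /solve r1 /solve r2 gE.
  rewrite [Y j l (+) _]addbC addbACA r1 r2 gE.
  move: (A j (+) _) (A l (+) _) (B j (+) _) (B l (+) _) (g (+) G j l) (addbN g (G j l)).
  by move=> [] [] [] [] [] ->.
rewrite /sum6 addbACA [X in X (+) _]addbACA (pair i0 i1) // (pair i0 i2) // (pair i1 i2) //.
move: (A i0 (+) _ (+) _) (A i1 (+) _ (+) _) (A i2 (+) _ (+) _).
by case; case; case.
Qed.

Variables (R : realType) (V : finType) (e : rel V).
Hypotheses (e_sym : symmetric e) (e_irr : irreflexive e).
Variables (phi : V -> R * R) (c : V -> V -> R -> R * R).
Hypothesis dr : plane_drawing e phi c.

Lemma disjoint_edges a x b y : e a x -> e b y -> a != b -> a != y -> x != b -> x != y ->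
  forall s t : R, 0 <= s <= 1 -> 0 <= t <= 1 -> c a x s != c b y t.
Proof.
move=> eax eby ab ay xb xy s t hs ht; apply/eqP => eq.
have ne : [set a; x] != [set b; y].
  by apply/eqP => /setP/(_ a); rewrite !inE eqxx (negbTE ab) (negbTE ay).
have [v []] := drawing_cross dr eax eby ne hs ht eq.
by rewrite !inE => /orP[] /eqP ->; rewrite ?(negbTE ab) ?(negbTE ay) ?(negbTE xb) ?(negbTE xy).
Qed.

(* For disjoint edges pp' and qq', the vector from a point of one to a point of
   the other is a map from a square to the punctured plane, whose boundary
   crosses a ray an even number of times. Summing these relations over all
   pairs of disjoint edges gives a contradiction modulo 2. *)
Lemma no_K33 (a0 a1 a2 x0 x1 x2 : V) :
  uniq [:: a0; a1; a2] -> uniq [:: x0; x1; x2] ->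
  ~ {in [:: a0; a1; a2] & [:: x0; x1; x2], forall a x, e a x}.
Proof.
set As := [:: a0; a1; a2]; set Xs := [:: x0; x1; x2] => uA uX H.
have neAX a x : a \in As -> x \in Xs -> a != x.
  by move=> aA xX; apply: contraTneq (H a x aA xX) => ->; rewrite e_irr.
pose h u v := upper (phi u - phi v).
have hN u v : u != v -> h v u = ~~ h u v.
  move=> uv; rewrite /h -upperN ?opprB // subr_eq0.
  by apply: contra_neq uv; apply: (drawing_inj dr).
pose par n a x v := ray_parity n (c a x) (phi v).
have [n rel] : exists n, forall a b x y, a \in As -> b \in As -> x \in Xs -> y \in Xs ->
    a != b -> x != y ->
    (par n a x b (+) par n a x y) (+) (par n b y a (+) par n b y x) =
    (h a b (+) h a y) (+) (h x b (+) h x y).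
  (* There are finitely many quadruples, so one mesh serves all of them. *)
  suff : \forall n \near \oo%classic, forall t : V * V * V * V,
      let: (a, b, x, y) := t in
      a \in As -> b \in As -> x \in Xs -> y \in Xs -> a != b -> x != y ->
      (par n a x b (+) par n a x y) (+) (par n b y a (+) par n b y x) =
      (h a b (+) h a y) (+) (h x b (+) h x y).
    move=> /filter_ex[n Hn]; exists n => a b x y; exact: (Hn (a, b, x, y)).
  apply: filter_forall => -[[[a b] x] y].
  have [/and5P[aA bA xX yX /andP[ab xy]]|hyp] :=
    boolP [&& a \in As, b \in As, x \in Xs, y \in Xs, a != b & x != y]; last first.
    apply: nearW => n aA bA xX yX ab xy.
    by rewrite aA bA xX yX ab xy in hyp.
  have eax := H a x aA xX; have eby := H b y bA yX.
  have xb : x != b by rewrite eq_sym neAX.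
  have := disjoint_crossings (drawing_curve dr eax) (drawing_curve dr eby)
    (disjoint_edges eax eby ab (neAX a y aA yX) xb xy).
  have [-> ->] := drawing_ends dr eax; have [-> ->] := drawing_ends dr eby.
  by apply: filterS => n Hn _ _ _ _ _ _; exact: Hn.
move: uA uX; rewrite /= !inE !andbT !negb_or => /andP[/andP[a01 a02] a12].
move=> /andP[/andP[x01 x02] x12].
have odd a b : a \in As -> b \in As -> a != b ->
    sum6 x0 x1 x2 (par n a) (+) sum6 x0 x1 x2 (par n b) = true.
  move=> aA bA ab.
  have [X0 X1 X2] : [/\ x0 \in Xs, x1 \in Xs & x2 \in Xs].
    by rewrite !inE !eqxx !orbT.
  have [x10 x20 x21] : [/\ x1 != x0, x2 != x0 & x2 != x1].
    by split; rewrite eq_sym.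
  apply: (@sum6_parity _ x0 x1 x2 (fun x => par n a x b) (fun y => par n b y a)
    (h a) (fun x => h x b) (h a b) (par n a) (par n b) h);
    by [apply: rel | apply: hN].
(* Three bits cannot be pairwise different. *)
have := odd a0 a1; have := odd a0 a2; have := odd a1 a2.
rewrite !inE !eqxx !orbT => /(_ isT isT a12) + /(_ isT isT a02) + /(_ isT isT a01).
by case: (sum6 _ _ _ (par n a0)); case: (sum6 _ _ _ (par n a1)); case: (sum6 _ _ _ (par n a2)).
Qed.

Lemma plane_common (K : {set V}) : #|K| = 3%N -> (#|common e setT K| <= 2)%N.
Proof.
move=> /eqP/cards3P[a0 [a1 [a2 [a01 a12 a20 ->]]]]; rewrite leqNgt; apply/negP.
move=> /card_gt2P[x0 [x1 [x2 [[X0 X1 X2] [x01 x12 x20]]]]].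
apply: (@no_K33 a0 a1 a2 x0 x1 x2).
- by rewrite /= !inE negb_or a01 a12 eq_sym a20.
- by rewrite /= !inE negb_or x01 x12 eq_sym x20.
move=> a x aA xX; rewrite e_sym.
have aK : a \in [set a0; a1; a2] by move: aA; rewrite !inE orbA.
by move: xX; rewrite !inE => /or3P[] /eqP ->; [case/commonP: X0|case/commonP: X1|case/commonP: X2]
  => _; apply.
Qed.

End K33.

(** * Obstacle embeddings from straight drawings *)

Section Hexagon.
Variable R : realType.
Implicit Types u v x y : R * R.

Lemma pi3_bounds : 0 < (pi / 3 : R) < pi / 2.
Proof. by have := pi_gt0 R; lra. Qed.

Lemma cos_pi3 : cos (pi / 3) = 2^-1 :> R.
Proof.
have /andP[h0 h2] := pi3_bounds.
have c0 : 0 < cos (pi / 3 : R) by apply: cos_gt0_pihalf; lra.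
have : cos (pi / 3 + pi / 3 + pi / 3) = -1 :> R.
  by rewrite -[RHS]cospi; congr cos; field.
rewrite !(cosD, sinD); have := cos2Dsin2 (pi / 3 : R).
move: c0; set c := cos _; set s := sin _ => c0 sq tri.
(* The product is 4c^3 - 3c + 1, which vanishes by the triple angle formula. *)
have : (c + 1) * (2 * c - 1) ^+ 2 = 0.
  transitivity ((c * c - s * s) * c - (s * c + c * s) * s + 1
    - 3 * c * (1 - (c ^+ 2 + s ^+ 2))); first by ring.
  by rewrite tri sq; ring.
move/eqP; rewrite mulf_eq0 expf_eq0 /= => /orP[/eqP|/eqP]; lra.
Qed.

Lemma sin_pi3_gt0 : 0 < sin (pi / 3 : R).
Proof. by apply: sin_gt0_pihalf; exact: pi3_bounds. Qed.

Lemma sin_pi3_sqr : sin (pi / 3) ^+ 2 = 3 / 4 :> R.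
Proof. by rewrite sin2cos2 cos_pi3; field. Qed.

(* Coordinates with respect to the two vertices at angles 0 and pi/3 of the
   unit hexagon. *)
Definition hexpoint v : R * R := (v.1 + v.2 / 2, sin (pi / 3) * v.2).

Definition rotate (t : R) v : R * R :=
  (v.1 * cos t - v.2 * sin t, v.1 * sin t + v.2 * cos t).

Lemma rotateD s t v : rotate (s + t) v = rotate s (rotate t v).
Proof. by rewrite /rotate cosD sinD /=; congr pair; ring. Qed.

Lemma rotate0 v : rotate 0 v = v.
Proof. by case: v => a b; rewrite /rotate cos0 sin0 /= !mulr1 !mulr0 subr0 add0r. Qed.

Lemma rotate_inj t : injective (rotate t).
Proof.
by apply: (can_inj (g := rotate (- t))) => v; rewrite -rotateD addNr rotate0.
Qed.

Lemma hexpoint_hexrot v : hexpoint v = rotate (pi / 3) (hexpoint (hexrot v)).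
Proof.
case: v => a b; rewrite /hexpoint /rotate /hexrot /= cos_pi3; congr pair; last by field.
have -> : (a + b + - a / 2) / 2 - sin (pi / 3) * - a * sin (pi / 3) =
  (a + b + - a / 2) / 2 + a * sin (pi / 3) ^+ 2 by ring.
by rewrite sin_pi3_sqr; field.
Qed.

Lemma hexpoint_iter i v :
  hexpoint v = rotate (i%:R * pi / 3) (hexpoint (iter i (@hexrot R) v)).
Proof.
elim: i => [|i IH]; first by rewrite !mul0r rotate0.
rewrite IH hexpoint_hexrot -rotateD -iterS; congr rotate.
by rewrite -[i.+1%:R]natr1; ring.
Qed.

Lemma rotate_polar s r t : rotate s (r * cos t, r * sin t) = (r * cos (s + t), r * sin (s + t)).
Proof. by rewrite /rotate cosD sinD /=; congr pair; ring. Qed.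

(** The angle is [acos (x / r)]; it is at most pi/3 because [r <= 2 * x]. *)
Lemma polar_quadrant v : 0 <= v.1 -> 0 <= v.2 ->
  exists r t : R, [/\ 0 <= r, 0 <= t <= pi / 3 & hexpoint v = (r * cos t, r * sin t)].
Proof.
case: v => a b /= a0 b0; rewrite /hexpoint /=.
set x := a + b / 2; set y := sin _ * b.
have x0 : 0 <= x by rewrite /x; lra.
have y0 : 0 <= y by rewrite mulr_ge0 // ltW // sin_pi3_gt0.
have yE : y ^+ 2 = 3 / 4 * b ^+ 2 by rewrite exprMn sin_pi3_sqr.
have xb : b <= 2 * x by rewrite /x; lra.
clearbody x y; pose r := Num.sqrt (x ^+ 2 + y ^+ 2).
have r2 : r ^+ 2 = x ^+ 2 + y ^+ 2 by rewrite sqr_sqrtr // addr_ge0 // sqr_ge0.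
have r0 : 0 <= r by apply: sqrtr_ge0.
clearbody r.
have [rz|rz] := eqVneq r 0.
  exists 0, 0; split; rewrite ?lexx //=; first by rewrite divr_ge0 // pi_ge0.
  move: r2; rewrite rz expr0n /= => /esym/eqP.
  rewrite paddr_eq0 ?sqr_ge0 // !sqrf_eq0 => /andP[/eqP -> /eqP ->].
  by rewrite !mul0r.
have rp : 0 < r by rewrite lt0r rz.
have rle : r <= 2 * x.
  rewrite -(@ler_pXn2r _ 2) ?nnegrE ?mulr_ge0 // r2 yE; nra.
have xr1 : x / r <= 1.
  rewrite ler_pdivrMr // mul1r -(@ler_pXn2r _ 2) ?nnegrE // r2 lerDl sqr_ge0.
  by [].
have xr0 : 2^-1 <= x / r by rewrite ler_pdivlMr //; lra.
have xr : -1 <= x / r <= 1 by rewrite xr1 andbT; lra.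
exists r, (acos (x / r)); split=> //.
- rewrite acos_ge0 //= leNgt; apply/negP => h.
  have /andP[p0 p1] := pi3_bounds; have pp := pi_gt0 R.
  have : cos (acos (x / r)) < cos (pi / 3).
    rewrite ltr_cos // in_itv /= ?acos_ge0 ?acos_lepi //.
    by apply/andP; split; lra.
  by rewrite acosK ?in_itv // cos_pi3 => ?; lra.
- rewrite acosK ?in_itv //= mulrCA divff // mulr1; congr pair.
  apply/eqP; rewrite sin_acos // -(@eqrXn2 _ 2) ?mulr_ge0 ?sqrtr_ge0 //; apply/eqP.
  rewrite [RHS]exprMn sqr_sqrtr; last by rewrite subr_ge0 expr_le1 // divr_ge0.
  by rewrite mulrBr mulr1 -exprMn mulrCA divff // mulr1 r2; ring.
Qed.

Lemma sector3_hexpoint (i : 'I_6) x v :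
  sector3 i x (x + hexpoint v) <-> in_closed_sector i v.
Proof.
rewrite /sector3 /= /in_closed_sector; split.
  case=> r [t [r0 /andP[t1 t2] /addrI]].
  have tE : t = i%:R * pi / 3 + (t - i%:R * pi / 3) by ring.
  rewrite (hexpoint_iter i) {1 2}tE -rotate_polar => /rotate_inj.
  move: t1 t2 {tE}; rewrite -[i.+1%:R]natr1; set s := t - _ => t1 t2.
  case: (iter i _ v) => a b; rewrite /hexpoint /= => -[e1 e2].
  have s0 : 0 <= s by rewrite /s; lra.
  have s1 : s <= pi / 3 by rewrite /s; lra.
  have pp := pi_gt0 R; have sp := sin_pi3_gt0.
  have sin_s : 0 <= sin s by apply: sin_ge0_pi; lra.
  have sin_d : 0 <= sin (pi / 3 - s) by apply: sin_ge0_pi; lra.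
  rewrite sinB cos_pi3 in sin_d.
  have b0 : 0 <= b by rewrite -(pmulr_rge0 _ sp) e2 mulr_ge0.
  rewrite b0 andbT -(pmulr_rge0 _ sp).
  (* The bracket is sin (pi/3 - s), nonnegative by [sin_d]. *)
  have -> : sin (pi / 3) * a = r * (sin (pi / 3) * cos s - 2^-1 * sin s).
    by rewrite mulrBr mulrCA -e1 mulrCA -e2; field.
  exact: mulr_ge0.
move=> /andP[a0 b0]; have [r [t [r0 /andP[t0 t1] E]]] := polar_quadrant a0 b0.
exists r, (i%:R * pi / 3 + t); split => //.
  by rewrite -[i.+1%:R]natr1; apply/andP; split; lra.
by rewrite (hexpoint_iter i) E rotate_polar.
Qed.

Lemma hexpointB u v : hexpoint (u - v) = hexpoint u - hexpoint v.
Proof. by rewrite /hexpoint /=; congr pair => /=; ring. Qed.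

Lemma hexpointZ k v : hexpoint (vscale k v) = vscale k (hexpoint v).
Proof. by rewrite /hexpoint /vscale /=; congr pair; ring. Qed.

Lemma hexpoint_inj : injective hexpoint.
Proof.
move=> [a b] [a' b'] [] /[swap] /(mulfI (lt0r_neq0 sin_pi3_gt0)) -> /addIr ->.
by [].
Qed.

Lemma in_closed_sectorZ i k v : 0 <= k -> in_closed_sector i v -> in_closed_sector i (vscale k v).
Proof.
by move=> k0 /andP[h1 h2]; rewrite /in_closed_sector iter_hexrotZ /= !mulr_ge0.
Qed.

Definition segment x y (t : R) : R * R := x + vscale t (y - x).

Lemma segment_curve x y : curve (segment x y).
Proof.
apply: continuous_subspaceT => t; rewrite /segment /vscale.
apply: cvgD; first exact: cvg_cst.
have cM (k : R) : (t' * k @[t' --> t] --> t * k)%classic.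
  by apply: cvgMr_tmp; apply: cvg_id.
exact: (cvg_pair (cM _) (cM _)).
Qed.

Lemma segment_sector (i : 'I_6) u v a b : a <= b ->
  in_closed_sector i (v - u) ->
  sector3 i (segment (hexpoint u) (hexpoint v) a) (segment (hexpoint u) (hexpoint v) b).
Proof.
move=> ab h.
have -> : segment (hexpoint u) (hexpoint v) b =
   segment (hexpoint u) (hexpoint v) a + hexpoint (vscale (b - a) (v - u)).
  by rewrite /segment hexpointZ hexpointB /vscale /=; congr pair => /=; ring.
by apply/sector3_hexpoint; apply: in_closed_sectorZ; rewrite ?subr_ge0.
Qed.

End Hexagon.

(** * From straight drawings to monotone walks *)

Section StraightDrawing.
Variables (R : realType) (V : finType) (e : rel V).
Hypotheses (e_sym : symmetric e) (e_irr : irreflexive e).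
Variables (phi : V -> R * R) (F : face V -> Prop).
Hypothesis dr : drawn e setT phi F.

Definition position (v : V) : R * R := hexpoint (phi v).

Definition straight (u w : V) : R -> R * R := segment (position u) (position w).

Definition edge_weight (u w : V) (t : R) (x : V) : R :=
  (1 - t) * (x == u)%:R + t * (x == w)%:R.

Lemma edge_weight_mem u w t x : edge_weight u w t x != 0 -> x \in [:: u; w].
Proof.
apply: contraNT; rewrite /edge_weight !inE negb_or => /andP[/negbTE -> /negbTE ->].
by rewrite !mulr0 addr0.
Qed.

Lemma edge_weight_sum u w t (g : V -> R) :
  \sum_x edge_weight u w t x * g x = (1 - t) * g u + t * g w.
Proof.
have one v (k : R) : \sum_x k * (x == v)%:R * g x = k * g v.
  rewrite (bigD1 v) //= eqxx mulr1 big1 ?addr0 // => x /negbTE ->.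
  by rewrite mulr0 mul0r.
by rewrite -!one -big_split; apply: eq_bigr => x _; rewrite /edge_weight mulrDl.
Qed.

Lemma bary_edge u w t : (u == w) || e u w -> 0 <= t <= 1 ->
  bary e setT F (edge_weight u w t).
Proof.
move=> uw /andP[t0 t1].
have sub : support (edge_weight u w t) \subset [set u; w].
  by apply/subsetP => x; rewrite inE => /edge_weight_mem; rewrite !inE.
have card2 : (#|support (edge_weight u w t)| <= 2)%N.
  by apply: leq_trans (subset_leq_card sub) _; rewrite cards2; case: eqP.
split.
- by move=> x; rewrite addr_ge0 // mulr_ge0 // subr_ge0.
- transitivity (\sum_x edge_weight u w t x * 1); first by apply: eq_bigr => x _; rewrite mulr1.
  by rewrite (edge_weight_sum _ _ _ (fun=> 1)) !mulr1 subrK.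
- split; rewrite ?subsetT //; last 2 first.
  + exact: leq_trans card2 _.
  + by move=> c3; rewrite c3 in card2.
  move=> x y /(subsetP sub) + /(subsetP sub); rewrite !inE.
  case/orP: uw => [/eqP <-|uw]; first by rewrite !orbb => /eqP -> /eqP ->; rewrite eqxx.
  by move=> /orP[] /eqP -> /orP[] /eqP ->; rewrite ?eqxx // e_sym.
Qed.

Lemma straight_inj u w x y s t : (u == w) || e u w -> (x == y) || e x y ->
  0 <= s <= 1 -> 0 <= t <= 1 -> straight u w s = straight x y t ->
  edge_weight u w s =1 edge_weight x y t.
Proof.
move=> uw xy hs ht.
have E a b r : straight a b r = hexpoint (segment (phi a) (phi b) r).
  by rewrite /straight /segment /position /hexpoint /vscale /=; congr pair => /=; ring.
rewrite !E => /hexpoint_inj; rewrite /segment /vscale => -[e1 e2].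
apply: (drawn_inj dr); try exact: bary_edge.
split; rewrite !edge_weight_sum.
  by transitivity ((phi u).1 + s * ((phi w).1 - (phi u).1)); [ring | rewrite e1; ring].
by transitivity ((phi u).2 + s * ((phi w).2 - (phi u).2)); [ring | rewrite e2; ring].
Qed.

Lemma straight0 u w : straight u w 0 = position u.
Proof. by rewrite /straight /segment /vscale !mul0r addr0. Qed.

Lemma straight1 u w : straight u w 1 = position w.
Proof.
by rewrite /straight /segment /vscale !mul1r -surjective_pairing addrC subrK.
Qed.

Lemma edge_weight_l u w t : u != w -> edge_weight u w t u = 1 - t.
Proof. by move=> /negbTE uw; rewrite /edge_weight eqxx uw mulr0 addr0 mulr1. Qed.

Lemma edge_weight_r u w t : u != w -> edge_weight u w t w = t.
Proof. by move=> uw; rewrite /edge_weight eqxx eq_sym (negbTE uw) mulr0 add0r mulr1. Qed.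

Lemma edge_neq u w : e u w -> u != w.
Proof. by apply: contraTneq => ->; rewrite e_irr. Qed.

Lemma straight_plane : plane_drawing e position straight.
Proof.
have I0 : 0 <= (0 : R) <= 1 by rewrite lexx ler01.
have refl u w : e u w -> (u == w) || e u w by move=> ->; rewrite orbT.
split.
- move=> u w uw; have := @straight_inj u u w w 0 0; rewrite !eqxx !straight0.
  move=> /(_ isT isT I0 I0 uw u); rewrite /edge_weight eqxx subr0 mul0r addr0 mulr1.
  case: eqP => // _; rewrite mulr0 mul0r addr0 => /eqP; by rewrite oner_eq0.
- by move=> u w _; apply: segment_curve.
- by move=> u w _; rewrite straight0 straight1.
- move=> u w _ t _; rewrite /curve_rev /straight /segment /vscale /=.
  by congr pair => /=; ring.
- move=> u w uw s t hs ht /(straight_inj (refl _ _ uw) (refl _ _ uw) hs ht)/(_ w).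
  by rewrite !edge_weight_r // edge_neq.
- move=> u w uw v t ht; rewrite -(straight0 v v).
  have vv : (v == v) || e v v by rewrite eqxx.
  move/(straight_inj (refl _ _ uw) vv ht I0)/(_ v) => E; apply: (@edge_weight_mem _ _ t); rewrite E.
  by rewrite /edge_weight eqxx subr0 mul0r addr0 mulr1 oner_neq0.
move=> u w x y uw xy ne s t hs ht eq.
have E := straight_inj (refl _ _ uw) (refl _ _ xy) hs ht eq.
have nuw := edge_neq uw; have nxy := edge_neq xy.
have in_xy z : edge_weight u w s z != 0 -> z \in [:: x; y].
  by rewrite E; apply: edge_weight_mem.
(* If both ends of [uw] carry weight, both lie in [xy] and the edges coincide; otherwise the common
   point is an end. *)
have [Wu|/in_xy ux] := eqVneq (edge_weight u w s u) 0.
  move: Wu; rewrite edge_weight_l // => /eqP; rewrite subr_eq0 => /eqP s1.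
  exists w; split; [by rewrite !inE eqxx orbT | | by rewrite -s1 straight1].
  by apply: in_xy; rewrite edge_weight_r // -s1 oner_neq0.
have [Ww|/in_xy wx] := eqVneq (edge_weight u w s w) 0.
  move: Ww; rewrite edge_weight_r // => s0.
  by exists u; split; [rewrite !inE eqxx | | rewrite s0 straight0].
case/negP: ne; rewrite eqEcard !cards2 nuw nxy leqnn andbT.
by apply/subsetP => z; rewrite !inE => /orP[] /eqP ->; [move: ux|move: wx]; rewrite !inE.
Qed.

Lemma straight_monotone u w : e u w -> delta3_monotone (straight u w).
Proof.
move=> uw; have d6 := drawn_dir dr (in_setT u) (in_setT w) uw.
exists (Ordinal d6) => a b _ ab _; apply: segment_sector => //=.
exact: in_sector_closed (in_sector_sector d6).
Qed.

Definition monotone_in (i : 'I_6) (f : R -> R * R) : Prop :=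
  forall a b : R, 0 <= a -> a <= b -> b <= 1 -> sector3 i (f a) (f b).

Lemma monotone_cat i f g : f 1 = g 0 -> monotone_in i (curve_cat f g) ->
  monotone_in i f /\ monotone_in i g.
Proof.
move=> fg; have two t : 2 * (t / 2) = t :> R by field.
have cf t : t <= 1 -> curve_cat f g (t / 2) = f t.
  by move=> t1; rewrite /curve_cat two ifT //; lra.
have cg t : 0 <= t -> curve_cat f g ((t + 1) / 2) = g t.
  move=> t0; rewrite /curve_cat two addrK; case: ifP => // h.
  have -> : t = 0 by lra.
  by rewrite add0r fg.
move=> m; split=> a b a0 ab b1.
  by rewrite -!cf //; [apply: m; lra | lra].
by rewrite -!cg //; [apply: m; lra | lra].
Qed.

Lemma straight_dir i u w : e u w -> monotone_in i (straight u w) -> dir phi u w = i.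
Proof.
move=> uw m; have d6 := drawn_dir dr (in_setT u) (in_setT w) uw.
have := m 0 1 (lexx _) ler01 (lexx _).
rewrite straight0 straight1 /position -[hexpoint (phi w)](subrK (hexpoint (phi u))).
rewrite -hexpointB addrC => /sector3_hexpoint.
exact: closed_sector_inj (in_sector_sector d6).
Qed.

Lemma walk_edge i u v p : path e u (v :: p) -> monotone_in i (walk_curve straight u v p) ->
  e u (last v p).
Proof.
have start u' v' q : walk_curve straight u' v' q 0 = position u'.
  elim: q u' v' => [|w q IH] u' v' /=; first exact: straight0.
  by rewrite /curve_cat invr_ge0 ler0n mulr0 straight0.
(* The edges walked so far are replaced by a single edge from [u] to [v'] in sector [i]. *)
have key q : forall v', path e v' q -> e u v' -> dir phi u v' = i ->
    (forall w q', q = w :: q' -> monotone_in i (walk_curve straight v' w q')) ->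
    e u (last v' q).
  elim: q => [//|w q IH] v' /= /andP[v'w pq] uv' duv' m.
  have {m} m := m w q erefl.
  have [dvw m'] : dir phi v' w = i /\
      (forall w' q', q = w' :: q' -> monotone_in i (walk_curve straight w w' q')).
    case: q m {IH} pq => [|w' q'] m pq; first by split=> //; apply: straight_dir.
    have [|m1 m2] := monotone_cat _ m; first by rewrite straight1; apply/esym/start.
    by split; [exact: straight_dir | move=> _ _ [<- <-]].
  have uw : e u w.
    by apply: (drawn_turn dr (in_setT u) (in_setT v') (in_setT w)) => //; rewrite duv'.
  apply: IH => //.
  (* An open sector is a convex cone, so the sum of two of its vectors stays in it. *)
  have d1 := drawn_dir dr (in_setT u) (in_setT v') uv'.
  have d2 := drawn_dir dr (in_setT v') (in_setT w) v'w.
  apply: sectorE => //.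
  have /andP[h1 h2] := in_sector_sector d1; have /andP[h3 h4] := in_sector_sector d2.
  rewrite -!/(dir _ _ _) duv' in h1 h2; rewrite -!/(dir _ _ _) dvw in h3 h4.
  rewrite -[phi w](subrK (phi v')) -addrA /in_sector iter_hexrotD.
  by apply/andP; split; apply: addr_gt0.
move=> /= /andP[uv pv] m; case: p pv m => [|w p] //= pv m.
have [|m1 m2] := monotone_cat _ m; first by rewrite straight1; apply/esym/start.
by apply: (key (w :: p) v pv uv (straight_dir uv m1)) => _ _ [<- <-].
Qed.

Lemma straight_embedding : delta3_obstacle_embedding e position straight.
Proof.
split; [exact: straight_plane | exact: straight_monotone|].
by move=> u v p pth _ _ [i]; apply: walk_edge.
Qed.

End StraightDrawing.

Theorem theorem21 (R : realType) (V : finType) (e : rel V)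
    (e_sym : symmetric e) (e_irr : irreflexive e)
    (e_three_tree : three_tree e) (e_planar : planar R e) :
  exists (phi : V -> (R * R)%type) (c : V -> V -> R -> (R * R)%type),
    delta3_obstacle_embedding e phi c.
Proof.
have [phi0 [c0 dr0]] := e_planar.
have [phi [F dr]] := three_tree_drawn R e_sym e_irr e_three_tree
  (fun K => plane_common e_sym e_irr dr0 (K := K)).
by exists (position phi), (straight phi); apply: straight_embedding dr.
Qed.
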